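(* Let $\sigma^2>0$ and let $\epsilon\sim q(\epsilon;\sigma^2)=\mathcal{N}(0,\sigma^2 I)$ be independent of $(x,d,z)$. Let $C=\mathbb{E}_{q(d)}[\mathrm{H}(q(x|d))]$. (1) (Flow-based.) Suppose $z=g(x|d)$ where $g(\cdot|d)$ is invertible for each $d$ (so that $q(z|x,d)$ is the Dirac delta at $g(x|d)$), and define $\mathrm{NAUB}(q(z|x,d);\sigma^2)$ by $$\mathrm{NAUB}(q(z|x,d);\sigma^2)+C=\min_{p(\tilde z)}\ \mathbb{E}_{q(x,d)q(\epsilon;\sigma^2)}\big[-\log\big(|J_g(x|d)|\cdot p(g(x|d)+\epsilon)\big)\big].$$ Then $$\mathrm{NAUB}(q(z|x,d);\sigma^2)\ \ge\ \mathrm{NJSD}(\{q(z|d)\}_{d=1}^k;\sigma^2).$$ (2) (VAE-based.) For a probabilistic encoder $q(z|x,d)$, define $\mathrm{NVAUB}(q(z|x,d);\sigma^2)$ by $$\mathrm{NVAUB}(q(z|x,d);\sigma^2)+C=\min_{p(\tilde z),\,p(x|z,d)}\ \mathbb{E}_{q(x,z,d)q(\epsilon;\sigma^2)}\left[-\log\left(\frac{p(x|z,d)}{q(z|x,d)}\cdot p(z+\epsilon)\right)\right].$$ Then $$\mathrm{NVAUB}(q(z|x,d);\sigma^2)\ \ge\ \mathrm{NJSD}(\{q(z|d)\}_{d=1}^k;\sigma^2).$$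
   Context: Let $x$ be an observed continuous random vector and $d\in\{1,\dots,k\}$, $k>1$, a domain label with joint data distribution $q(x,d)$; $q(d)$ is the marginal of $d$ and $q(x|d)$ the conditional density of $x$. An encoder $q(z|x,d)$ is a conditional distribution of a latent vector $z$ (a conditional density in the VAE-based case), and $q(x,d,z)=q(x,d)q(z|x,d)$; $q(z|d)$ is the resulting conditional density of $z$ given $d$. In the flow-based case $g(\cdot|d)$ is invertible and differentiable with differentiable inverse, and $|J_g(x|d)|$ is the absolute value of its Jacobian determinant. The minima are over given classes of densities $p(\tilde z)$ on the latent space (not depending on $d$) and, in the VAE-based case, of conditional densities (decoders) $p(x|z,d)$. $\mathrm{H}$ denotes (differential) entropy. The generalized Jensen-Shannon divergence is $\mathrm{GJSD}(\{r(z|d)\}_{d=1}^k)=\mathrm{H}(\mathbb{E}_{q(d)}[r(z|d)])-\mathbb{E}_{q(d)}[\mathrm{H}(r(z|d))]$. The noisy version is $$\mathrm{NJSD}(\{q(z|d)\}_{d=1}^k;\sigma^2)=\mathrm{GJSD}(\{q(\tilde z|d)\}_{d=1}^k),$$ where $q(\tilde z|d)=q(z|d)\ast\mathcal{N}(0,\sigma^2 I)$ is the conditional density of $\tilde z=z+\epsilon$ given $d$. All entropies and expectations appearing are understood to be well-defined and finite, and the minima are understood to be attained. *)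

(* Defs.v *)
From HB Require Import structures.
From mathcomp Require Import all_boot all_order all_algebra.
From mathcomp Require Import all_classical all_reals all_analysis.

Set Implicit Arguments.
Unset Strict Implicit.
Unset Printing Implicit Defensive.

Import Order.TTheory GRing.Theory Num.Theory.
Import numFieldNormedType.Exports.

Local Open Scope classical_set_scope.
Local Open Scope ring_scope.

Section measurable_rV.
Variables (R : realType) (n : nat).

(* The product of the Borel sigma-algebras of the coordinates, i.e. the Borel
   sigma-algebra of R^n (same construction as the library's for n.-tuple). *)
Let coords : 'I_n -> 'rV[R]_n -> R := fun i v => v ord0 i.

Let rV_set0 : g_sigma_preimage coords set0.
Proof. exact: sigma_algebra0. Qed.

Let rV_setC A : g_sigma_preimage coords A -> g_sigma_preimage coords (~` A).
Proof. exact: sigma_algebraC. Qed.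

Let rV_bigcup (F : (set 'rV[R]_n)^nat) :
  (forall i, g_sigma_preimage coords (F i)) ->
  g_sigma_preimage coords (\bigcup_i (F i)).
Proof. exact: sigma_algebra_bigcup. Qed.

HB.instance Definition _ :=
  @isMeasurable.Build (measure_tuple_display default_measure_display)
    'rV[R]_n (g_sigma_preimage coords) rV_set0 rV_setC rV_bigcup.

Lemma measurable_coord_rV (i : 'I_n) :
  measurable_fun [set: 'rV[R]_n] (fun v => v ord0 i).
Proof.
move=> _ Y mY; rewrite setTI; apply: sub_sigma_algebra => /=.
rewrite -bigcup_seq/=; exists i => /=; first by rewrite mem_index_enum.
by exists Y => //; rewrite setTI.
Qed.

Lemma measurable_fun_rV d (T : measurableType d) (f : T -> 'rV[R]_n) :
  (forall i, measurable_fun [set: T] (fun t => f t ord0 i)) ->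
  measurable_fun [set: T] f.
Proof.
move=> mf.
suff sub : g_sigma_preimage (fun i => coords i \o f) `<=` measurable.
  by move: sub; rewrite g_sigma_preimage_comp => + _ A mA; apply; exists A.
apply: smallest_sub; first exact: sigma_algebra_measurable.
rewrite -bigcup_seq/=; apply: bigcup_sub => i _ _ [Y mY <-].
exact: mf.
Qed.

End measurable_rV.

Section lebesgue_rV.
Variable R : realType.
Local Open Scope ereal_scope.

Definition rV_cons n (p : measurableTypeR R * 'rV[R]_n) : 'rV[R]_n.+1 :=
  row_mx (const_mx p.1 : 'rV[R]_1) p.2.

Lemma rV_consE0 n p : @rV_cons n p ord0 ord0 = p.1.
Proof.
have -> : ord0 = lshift n (ord0 : 'I_1) by apply/val_inj.
by apply: etrans (row_mxEl _ _ _ _) _; rewrite mxE.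
Qed.

Lemma rV_consES n p (i : 'I_n) : @rV_cons n p ord0 (lift ord0 i) = p.2 ord0 i.
Proof.
have -> : lift ord0 i = rshift 1 i by apply/val_inj.
exact: row_mxEr.
Qed.

Lemma measurable_rV_cons n : measurable_fun setT (@rV_cons n).
Proof.
apply: measurable_fun_rV => i; case: (unliftP ord0 i) => [j ->|->].
  under eq_fun do rewrite rV_consES.
  exact: (measurableT_comp (measurable_coord_rV j) measurable_snd).
under eq_fun do rewrite rV_consE0.
exact: measurable_fst.
Qed.

(* n-dimensional Lebesgue measure, as an iterated product measure. *)
Fixpoint lebesgue_rV (n : nat) : set 'rV[R]_n -> \bar R :=
  match n with
  | 0%N => \d_(0%R : 'rV[R]_0)
  | n'.+1 =>
      pushforward ((@lebesgue_measure R) \x (@lebesgue_rV n')) (@rV_cons n')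
  end.

Let lebesgue_rV_ex n :
  exists mu : {sigma_finite_measure set 'rV[R]_n -> \bar R},
    mu = @lebesgue_rV n :> (set 'rV[R]_n -> \bar R).
Proof.
elim: n => [|n [mu muE]].
  by exists (\d_(0%R : 'rV[R]_0) : {sigma_finite_measure set _ -> \bar R}).
pose nu : {measure set (measurableTypeR R * 'rV[R]_n)%type -> \bar R} :=
  (@lebesgue_measure R) \x mu.
have sfnu : sigma_finite setT nu.
  have /sigma_finiteP[F [TF ndF Foo]] := sigma_finiteT (@lebesgue_measure R).
  have /sigma_finiteP[G [TG ndG Goo]] := sigma_finiteT mu.
  exists (fun i => F i `*` G i).
    rewrite -setXTT TF TG predeqE => -[x y]; split.
      move=> [/= [i _ Fx] [j _ Gy]]; exists (maxn i j) => //; split.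
      - by move: x Fx; exact/subsetPset/ndF/leq_maxl.
      - by move: y Gy; exact/subsetPset/ndG/leq_maxr.
    by move=> [i _ []/= ? ?]; split; exists i.
  move=> i; have [? ?] := Foo i; have [? ?] := Goo i.
  split; first exact: measurableX.
  by rewrite /nu /= product_measure1E// lte_mul_pinfty// ge0_fin_numE.
pose rho : {measure set 'rV[R]_n.+1 -> \bar R} :=
  measure_function_pushforward__canonical__measure_function_Measure nu
    (@measurable_rV_cons n).
have rhoE : rho = @lebesgue_rV n.+1 :> (set 'rV[R]_n.+1 -> \bar R).
  by rewrite /= -muE.
have sfrho : sigma_finite setT rho.
  have [F FT Ffin] := sfnu.
  pose u (v : 'rV[R]_n.+1) : measurableTypeR R * 'rV[R]_n :=
    (v ord0 ord0, \row_i v ord0 (lift ord0 i)).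
  have mu_ : measurable_fun setT u.
    apply: measurable_fun_pair; first exact: measurable_coord_rV.
    apply: measurable_fun_rV => i.
    under eq_fun do rewrite mxE.
    exact: measurable_coord_rV.
  have uK p : u (rV_cons p) = p.
    case: p => t v; congr pair; first exact: rV_consE0.
    by apply/rowP => i; rewrite mxE rV_consES.
  exists (fun i => u @^-1` F i).
    by rewrite -preimage_bigcup -FT preimage_setT.
  move=> i; have [mF Fi] := Ffin i; split.
    by rewrite -[X in measurable X]setTI; exact: mu_.
  rewrite /rho /= /pushforward (_ : _ @^-1` _ = F i)//.
  by apply/seteqP; split => p /=; rewrite uK.
by exists (HB.pack_for {sigma_finite_measure set 'rV[R]_n.+1 -> \bar R}
  (Measure.sort rho) (@Measure_isSigmaFinite.Build _ _ _ rho sfrho)).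
Qed.

Let lebesgue_rV0 n : @lebesgue_rV n set0 = 0.
Proof. by have [mu <-] := lebesgue_rV_ex n. Qed.

Let lebesgue_rV_ge0 n A : 0 <= @lebesgue_rV n A.
Proof. by have [mu <-] := lebesgue_rV_ex n. Qed.

Let lebesgue_rV_sigma_additive n : semi_sigma_additive (@lebesgue_rV n).
Proof.
by have [mu <-] := lebesgue_rV_ex n; exact: measure_semi_sigma_additive.
Qed.

Let lebesgue_rV_sigma_finite n : sigma_finite setT (@lebesgue_rV n).
Proof. by have [mu <-] := lebesgue_rV_ex n; exact: sigma_finiteT. Qed.

HB.instance Definition _ n := isMeasure.Build _ _ _ (@lebesgue_rV n)
  (@lebesgue_rV0 n) (@lebesgue_rV_ge0 n) (@lebesgue_rV_sigma_additive n).

HB.instance Definition _ n := @Measure_isSigmaFinite.Build _ _ _ (@lebesgue_rV n)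
  (@lebesgue_rV_sigma_finite n).

End lebesgue_rV.
Arguments lebesgue_rV {R} n.

Lemma lebesgue_rV_box (R : realType) p (A : 'I_p -> set R)   :
  (forall i, measurable (A i)) ->
  lebesgue_rV p [set v : 'rV[R]_p | forall i, A i (v ord0 i)] =
    (\prod_(i < p) lebesgue_measure (A i))%E.
Proof.
elim: p A => [|p IH] A mA.
  rewrite big_ord0 /= diracE mem_set//=. by case.
rewrite big_ord_recl -IH; last by move=> i; exact: mA.
rewrite /= /pushforward -product_measure1E//; last first.
- rewrite (_ : [set _ | _] = \bigcap_(i in [set: 'I_p]) [set v : 'rV[R]_p |
      A (lift ord0 i) (v ord0 i)]).
    apply: fin_bigcap_measurable => [|i _]; [exact: finite_finset|]; have := @measurable_coord_rV R p i.
    by move=> /(_ measurableT _ (mA (lift ord0 i))); rewrite setTI.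
  apply/seteqP; split=> v /= h i; [by move=> _; exact: h | exact: (h i)].
- exact: mA.
congr (_ _); apply/seteqP; split => -[t v] /=.
  move=> h; split => /=; first by have := h ord0; rewrite rV_consE0.
  by move=> i; have := h (lift ord0 i); rewrite rV_consES.
move=> [h0 h] i; case: (unliftP ord0 i) => [j ->|->].
  by rewrite rV_consES.
by rewrite rV_consE0.
Qed.

Section information.
Context {R : realType}.
Local Open Scope ereal_scope.

(* lne (rather than ln, for which ln 0 = 0) makes -log 0 = +oo. *)
Definition nlog (r : R) : \bar R := - lne r%:E.

Definition is_density d (T : measurableType d) (mu : set T -> \bar R)
    (p : T -> R) : Prop :=
  [/\ measurable_fun [set: T] p, forall x, (0 <= p x)%R &
      \int[mu]_x (p x)%:E = 1].

(* p x is a density on T' for every conditioning value x : T. *)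
Definition is_cond_density d d' (T : measurableType d) (T' : measurableType d')
    (mu : set T' -> \bar R) (p : T -> T' -> R) : Prop :=
  measurable_fun [set: T * T'] (fun w => p w.1 w.2) /\
  forall x, is_density mu (p x).

(* The expectation of f under the density q.  Here 0 * +oo = 0, so f is
   irrelevant where q vanishes.  As \int f = \int f^+ - \int f^- with
   +oo - +oo = -oo, for a measurable integrand the expectation is well-defined
   and finite iff this value is a fin_num. *)
Definition expect d (T : measurableType d) (mu : set T -> \bar R)
    (q : T -> R) (f : T -> \bar R) : \bar R :=
  \int[mu]_x ((q x)%:E * f x).

Definition entropy d (T : measurableType d) (mu : set T -> \bar R)
    (q : T -> R) : \bar R := expect mu q (fun x => nlog (q x)).

(* r is a density, with respect to nu, of f x when x has density q with respect
   to mu. *)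
Definition is_density_of_image d d' (T : measurableType d)
    (T' : measurableType d') (mu : set T -> \bar R) (nu : set T' -> \bar R)
    (q : T -> R) (f : T -> T') (r : T' -> R) : Prop :=
  is_density nu r /\
  forall A, measurable A ->
    \int[nu]_(z in A) (r z)%:E = \int[mu]_(x in f @^-1` A) (q x)%:E.

Definition is_pmf k (qd : 'I_k -> R) : Prop :=
  (forall d, 0 <= qd d)%R /\ (\sum_(d < k) qd d = 1)%R.

Definition domain_mean k (qd : 'I_k -> R) (F : 'I_k -> \bar R) : \bar R :=
  \sum_(d < k) (qd d)%:E * F d.

Definition mixture T k (qd : 'I_k -> R) (r : 'I_k -> T -> R) (z : T) : R :=
  (\sum_(d < k) qd d * r d z)%R.

Definition cond_entropy d (T : measurableType d) (mu : set T -> \bar R)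
    k (qd : 'I_k -> R) (r : 'I_k -> T -> R) : \bar R :=
  domain_mean qd (fun i => entropy mu (r i)).

Definition gjsd d (T : measurableType d) (mu : set T -> \bar R)
    k (qd : 'I_k -> R) (r : 'I_k -> T -> R) : \bar R :=
  entropy mu (mixture qd r) - cond_entropy mu qd r.

(* The density of N(0, s2 I); normal_pdf takes the standard deviation. *)
Definition gaussian n (s2 : R) (e : 'rV[R]_n) : R :=
  (\prod_(i < n) normal_pdf 0 (Num.sqrt s2) (e ord0 i))%R.

(* The convolution q * N(0, s2 I). *)
Definition noisy n (s2 : R) (q : 'rV[R]_n -> R) (w : 'rV[R]_n) : R :=
  (\int[lebesgue_rV n]_z (q z * gaussian s2 (w - z)))%R.

Definition njsd n k (qd : 'I_k -> R) (q : 'I_k -> 'rV[R]_n -> R) (s2 : R) :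
    \bar R :=
  gjsd (lebesgue_rV n) qd (fun d => noisy s2 (q d)).

(* The minimum of L over A; it is a true minimum under min_attained. *)
Definition minimum T (A : set T) (L : T -> \bar R) : \bar R :=
  ereal_inf (L @` A).

Definition min_attained T (A : set T) (L : T -> \bar R) : Prop :=
  exists2 a, A a & L a \is a fin_num /\ forall b, A b -> L a <= L b.

Section flow.
Variables (k n : nat) (qd : 'I_k -> R) (qx : 'I_k -> 'rV[R]_n -> R).
Variable g : 'I_k -> 'rV[R]_n -> 'rV[R]_n.

Definition is_flow : Prop :=
  forall d, exists ginv : 'rV[R]_n -> 'rV[R]_n,
    [/\ cancel (g d) ginv, cancel ginv (g d),
        forall x, differentiable (g d) x &
        forall z, differentiable ginv z].

Definition abs_jacobian (d : 'I_k) (x : 'rV[R]_n) : R :=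
  `| \det ('J (g d) x) |%R.

Definition naub_loss (s2 : R) (p : 'rV[R]_n -> R) : \bar R :=
  domain_mean qd (fun d =>
    expect (lebesgue_rV n \x lebesgue_rV n)
      (fun w => qx d w.1 * gaussian s2 w.2)%R
      (fun w => nlog (abs_jacobian d w.1 * p (g d w.1 + w.2))%R)).

Definition naub (s2 : R) (P : set ('rV[R]_n -> R)) : \bar R :=
  minimum P (naub_loss s2) - cond_entropy (lebesgue_rV n) qd qx.

End flow.

Section vae.
Variables (k m n : nat) (qd : 'I_k -> R) (qx : 'I_k -> 'rV[R]_m -> R).
(* enc d x z is q(z|x,d); a decoder dec d z x is p(x|z,d). *)
Variable enc : 'I_k -> 'rV[R]_m -> 'rV[R]_n -> R.

(* q(z|d); an infinite value of the integral, possible only on a null set, is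
   replaced by 0. *)
Definition latent (d : 'I_k) (z : 'rV[R]_n) : R :=
  (\int[lebesgue_rV m]_x (qx d x * enc d x z))%R.

Definition nvaub_loss (s2 : R)
    (pdec : ('rV[R]_n -> R) * ('I_k -> 'rV[R]_n -> 'rV[R]_m -> R)) : \bar R :=
  let: (p, dec) := pdec in
  domain_mean qd (fun d =>
    expect ((lebesgue_rV m \x lebesgue_rV n) \x lebesgue_rV n)
      (fun w => let: (x, z, e) := w in qx d x * enc d x z * gaussian s2 e)%R
      (fun w => let: (x, z, e) := w in
         nlog (dec d z x / enc d x z * p (z + e))%R)).

Definition nvaub (s2 : R) (P : set ('rV[R]_n -> R))
    (D : set ('I_k -> 'rV[R]_n -> 'rV[R]_m -> R)) : \bar R :=
  minimum (P `*` D) (nvaub_loss s2) - cond_entropy (lebesgue_rV m) qd qx.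

End vae.

End information.

(* Main.v *)
Require Import Defs.
From HB Require Import structures.
From mathcomp Require Import all_boot all_order all_algebra.
From mathcomp Require Import all_classical all_reals all_analysis.
From mathcomp Require Import measurable_realfun ring lra.

Import Order.TTheory GRing.Theory Num.Theory.
Import numFieldNormedType.Exports.

Set Implicit Arguments.
Unset Strict Implicit.
Unset Printing Implicit Defensive.

Local Open Scope classical_set_scope.
Local Open Scope ring_scope.
Local Open Scope ereal_scope.

(** Write [r_d] for the density of the noisy latent [w] given [d], [m] for the
mixture of the [r_d], [Q_d] for the joint density of the encoder input, the
latent and the noise, and [X_d = u_d * p(w)] for the argument of the logarithm
in the loss.  Since [log y <= y - 1],
[[
  Q_d + Q_d nlog q(x|d) + Q_d nlog m(w)
     <= Q_d nlog X_d + Q_d nlog r_d(w) + Q_d X_d r_d(w) / (q(x|d) m(w)).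
]]
Averaging over [d] and integrating yields [1 + C + H(m) <= loss + E[H(r_d)] + I],
where [I] is the integral of the last term, so that [I <= 1] is all that is
needed.  No entropy of the noiseless latent appears, hence none has to be finite.
In [I] the factor [q(x|d)] cancels, so that [I <= \int p (sum_d q(d) r_d) / m <= 1]
as soon as [w] pushes the measure with density [u_d Q_d / q(x|d)] to a measure
dominated by Lebesgue measure.  For a decoder this is Tonelli's theorem.  For a flow it follows from
[\int |J_g(x)| f(g x) dx <= \int f] for the Gaussian [f] centred at [w].

That inequality, for [g] and [h = g^-1] everywhere differentiable (not
necessarily C^1), comes from Fatou's lemma along dyadic grids: the averages over
the dyadic cell of [x] of the image of [f dz] under [h] have integral [\int f],
and their lower limit is at least [|J_g(x)| f(g x)], because differentiability of
[h] at [g x] puts the image under the linear part of [g] of a slightly shrunk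
cell inside the image of the cell under [g]. *)

(** * Linear images of Lebesgue measure *)

Section lebesgue_affine.
Context {R : realType}.
Local Notation mu := (@lebesgue_measure R).

(** The pushforward of Lebesgue measure under the affine map, scaled by [a], gives every half-open
    interval its length, so it is Lebesgue measure by uniqueness. *)
Lemma ge0_integral_affine_pos (a c : R) (f : R -> \bar R) : (0 < a)%R ->
  measurable_fun [set: R] f -> (forall x, 0 <= f x) ->
  a%:E * \int[mu]_x f (a * x + c)%R = \int[mu]_x f x.
Proof.
move=> a0 mf f0.
pose phi (x : measurableTypeR R) : measurableTypeR R := (a * x + c)%R.
have mphi : measurable_fun setT phi.
  by apply: measurable_funD => //; apply: measurable_funM.
pose nu := pushforward mu phi.
pose a' : {nonneg R} := NngNum (ltW a0).
have nuE A : measurable A -> mu A = mscale a' nu A.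
  apply: lebesgue_measure_unique => _ [[x y] _ <-] /=.
  rewrite /mscale /nu /pushforward /=.
  rewrite -[pushforward _ _ _]/(mu (phi @^-1` _)).
  rewrite (_ : phi @^-1` _ = `] ((x - c) / a)%R, ((y - c) / a)%R]%classic).
    rewrite !lebesgue_measure_itv/= !lte_fin ltr_pM2r ?invr_gt0// ltrD2r.
    case: ifPn => _; last by rewrite mule0.
    by rewrite -!EFinD -EFinM; congr EFin; field; rewrite gt_eqF.
  apply/seteqP; split => t /=; rewrite !in_itv /= /phi.
    by rewrite ltr_pdivrMr// ler_pdivlMr// (mulrC t) ltrBlDr lerBrDr.
  by rewrite ltr_pdivrMr// ler_pdivlMr// (mulrC t) ltrBlDr lerBrDr.
rewrite [RHS](eq_measure_integral (mscale a' nu)); last by move=> A mA _; exact: nuE.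
rewrite ge0_integral_mscale//=.
by rewrite ge0_integral_pushforward.
Qed.

Lemma ge0_integral_translation (c : R) (f : R -> \bar R) :
  measurable_fun [set: R] f -> (forall x, 0 <= f x) ->
  \int[mu]_x f (x + c)%R = \int[mu]_x f x.
Proof.
move=> mf f0; rewrite -[RHS](@ge0_integral_affine_pos 1 c f)// mul1e.
by under [in RHS]eq_integral do rewrite mul1r.
Qed.

(** A negative [a] reduces to the positive case through the reflection [-%R], which preserves
    Lebesgue measure. *)
Lemma ge0_integral_scale (a : R) (f : R -> \bar R) : a != 0%R ->
  measurable_fun [set: R] f -> (forall x, 0 <= f x) ->
  `|a|%:E * \int[mu]_x f (a * x)%R = \int[mu]_x f x.
Proof.
move=> + mf f0; case: (ltgtP a 0%R) => // [a0|a0] _.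
  have mg : measurable_fun [set: R] (f \o -%R : R -> \bar R).
    exact: measurableT_comp.
  rewrite ltr0_norm//; transitivity (\int[mu]_x (f \o -%R) x).
    rewrite -[RHS](@ge0_integral_affine_pos (- a) 0 _); last 3 first.
    - by rewrite oppr_gt0.
    - exact: mg.
    - by move=> x; exact: f0.
    by congr (_ * _); apply: eq_integral => x _; congr f; ring.
  have mN : measurable_fun setT (-%R : measurableTypeR R -> measurableTypeR R) by [].
  rewrite -(@ge0_integral_pushforward _ _ _ _ R _ mN mu setT f)//.
  by apply: eq_measure_integral => A mA _; exact: lebesgue_measureN.
rewrite gtr0_norm// -[RHS](@ge0_integral_affine_pos a 0 f)//.
by under [in RHS]eq_integral do rewrite addr0.
Qed.

End lebesgue_affine.

Section lebesgue_rV_integral.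
Context {R : realType}.
Local Notation mu := (@lebesgue_measure R).

Lemma integral_lebesgue_rV0 (f : 'rV[R]_0 -> \bar R) :
  \int[lebesgue_rV 0]_v f v = f 0%R.
Proof.
rewrite /= integral_dirac//; last first.
  (* The space has a single point, so every preimage is empty or everything and [f] is automatically
     measurable. *)
  move=> _ Y mY; rewrite setTI.
  have [f0|f0] := pselect (Y (f 0%R)).
    by rewrite (_ : _ @^-1` _ = setT)//; apply/seteqP; split => // v _ /=; rewrite thinmx0.
  by rewrite (_ : _ @^-1` _ = set0)//; apply/seteqP; split => // v /=; rewrite thinmx0.
by rewrite diracT mul1e.
Qed.

Lemma ge0_integral_lebesgue_rVS n (f : 'rV[R]_n.+1 -> \bar R) :
  measurable_fun [set: 'rV[R]_n.+1] f -> (forall x, 0 <= f x) ->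
  \int[lebesgue_rV n.+1]_v f v =
  \int[mu \x lebesgue_rV n]_w f (rV_cons w).
Proof.
move=> mf f0.
exact: (ge0_integral_pushforward (@measurable_rV_cons R n)
  (mu \x lebesgue_rV n) measurableT mf (fun y _ => f0 y)).
Qed.

Lemma ge0_integral_lebesgue_rVS1 n (f : 'rV[R]_n.+1 -> \bar R) :
  measurable_fun [set: 'rV[R]_n.+1] f -> (forall x, 0 <= f x) ->
  \int[lebesgue_rV n.+1]_v f v =
  \int[mu]_t \int[lebesgue_rV n]_v f (rV_cons (t, v)).
Proof.
move=> mf f0; rewrite ge0_integral_lebesgue_rVS//.
rewrite (fubini_tonelli1 (fun w => f (rV_cons w)))//.
by apply: measurableT_comp => //; exact: measurable_rV_cons.
Qed.

Lemma ge0_integral_lebesgue_rVS2 n (f : 'rV[R]_n.+1 -> \bar R) :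
  measurable_fun [set: 'rV[R]_n.+1] f -> (forall x, 0 <= f x) ->
  \int[lebesgue_rV n.+1]_v f v =
  \int[lebesgue_rV n]_v \int[mu]_t f (rV_cons (t, v)).
Proof.
move=> mf f0; rewrite ge0_integral_lebesgue_rVS//.
rewrite (fubini_tonelli2 (fun w => f (rV_cons w)))//.
by apply: measurableT_comp => //; exact: measurable_rV_cons.
Qed.

End lebesgue_rV_integral.

(** * Translations and matrices acting on integrals over row vectors *)

Section lebesgue_rV_linear.
Context {R : realType}.
Local Notation mu := (@lebesgue_measure R).

Lemma measurable_rV_translation n (c : 'rV[R]_n) :
  measurable_fun [set: 'rV[R]_n] (fun v : 'rV[R]_n => (v + c)%R).
Proof.
apply: measurable_fun_rV => i; under eq_fun do rewrite mxE.
by apply: measurable_funD => //; exact: measurable_coord_rV.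
Qed.

Lemma measurable_rV_mulmx n p (A : 'M[R]_(n, p)) :
  measurable_fun [set: 'rV[R]_n] (fun v : 'rV[R]_n => v *m A).
Proof.
apply: measurable_fun_rV => i; under eq_fun do rewrite mxE.
apply: measurable_sum => j; apply: measurable_funM => //.
exact: measurable_coord_rV.
Qed.

Lemma rV_consD n (p q : R * 'rV[R]_n) :
  (rV_cons p + rV_cons q)%R = rV_cons (p.1 + q.1, p.2 + q.2)%R.
Proof.
apply/rowP => i; rewrite mxE.
by case: (unliftP ord0 i) => [j ->|->]; rewrite ?rV_consES ?rV_consE0//= mxE.
Qed.

Lemma rV_cons_mul_block n (p : R * 'rV[R]_n) (a : 'M[R]_1) (b : 'rV[R]_n)
    (c : 'cV[R]_n) (S : 'M[R]_n) :
  rV_cons p *m (block_mx a b c S : 'M[R]_n.+1) =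
  rV_cons (p.1 * a ord0 ord0 + (p.2 *m c) ord0 ord0, p.1 *: b + p.2 *m S)%R.
Proof.
rewrite /rV_cons [LHS](@mul_row_block R 1 1 n 1 n); apply: (congr2 (@row_mx R 1 1 n)).
  by apply/matrixP => i j; rewrite !ord1 !mxE big_ord1 !mxE.
by congr (_ + _)%R; apply/rowP => i; rewrite !mxE big_ord1 !mxE.
Qed.

Lemma rV_cons_surj n (v : 'rV[R]_n.+1) : exists p, v = rV_cons p.
Proof.
exists (v ord0 ord0, \row_i v ord0 (lift ord0 i)); apply/rowP => i.
case: (unliftP ord0 i) => [j ->|->]; last by rewrite rV_consE0.
by rewrite rV_consES/= mxE.
Qed.

(** Induction on the dimension: Tonelli separates the first coordinate, which is translated on the
    line, from the tail, which is translated by the induction hypothesis. *)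
Lemma ge0_integral_rV_translation n (c : 'rV[R]_n) (f : 'rV[R]_n -> \bar R) :
  measurable_fun [set: 'rV[R]_n] f -> (forall x, 0 <= f x) ->
  \int[lebesgue_rV n]_v f (v + c)%R = \int[lebesgue_rV n]_v f v.
Proof.
elim: n c f => [|n IH] c f mf f0.
  by rewrite !integral_lebesgue_rV0; congr f; rewrite !thinmx0.
have [[c0 c1] ->] := rV_cons_surj c.
have mfc : measurable_fun [set: 'rV[R]_n.+1] (fun v => f (v + rV_cons (c0, c1))%R).
  exact: (measurableT_comp mf (measurable_rV_translation _)).
rewrite !ge0_integral_lebesgue_rVS1//.
have mF : measurable_fun setT (f \o @rV_cons R n).
  exact: measurableT_comp mf (@measurable_rV_cons R n).
rewrite -[RHS](ge0_integral_translation c0); last 2 first.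
- apply: (measurable_fun_fubini_tonelli_F (m2 := lebesgue_rV n) _ mF) => w.
  exact: f0.
- by move=> t; exact: integral_ge0.
apply: eq_integral => t _.
rewrite -[RHS](IH c1)//; last exact: measurable_fun_pair2 mF.
by apply: eq_integral => v _; rewrite rV_consD.
Qed.

(** Only an inequality is recorded. It is stable under products, holds trivially for singular
    matrices, where equality can fail, and is all that the area inequality uses. *)
Definition contracts_lebesgue n (A : 'M[R]_n) :=
  forall f : 'rV[R]_n -> \bar R,
    measurable_fun [set: 'rV[R]_n] f -> (forall x, 0 <= f x) ->
  `|\det A|%:E * \int[lebesgue_rV n]_v f (v *m A) <= \int[lebesgue_rV n]_v f v.

Lemma contracts_lebesgue_mul n (A B : 'M[R]_n) :
  contracts_lebesgue A -> contracts_lebesgue B -> contracts_lebesgue (A *m B).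
Proof.
move=> hA hB f mf f0; apply: le_trans (hB _ mf f0).
rewrite det_mulmx normrM mulrC EFinM -muleA lee_wpmul2l ?lee_fin//.
under eq_integral do rewrite mulmxA.
apply: (hA (fun v => f (v *m B))) => //.
exact: measurableT_comp mf (measurable_rV_mulmx _).
Qed.

(** The pair [(t, v)] goes to [(a * t, t *: b + v *m S)]. For fixed [t] the tail undergoes [S] and
    then a translation, and the first coordinate is scaled by [a]; for [a = 0] the determinant
    vanishes. *)
Lemma contracts_lebesgue_ublock n (a : R) (b : 'rV[R]_n) (S : 'M[R]_n) :
  contracts_lebesgue S ->
  contracts_lebesgue (block_mx a%:M b 0 S : 'M[R]_n.+1).
Proof.
move=> hS f mf f0.
rewrite (det_ublock (a%:M : 'M[R]_1)) det_scalar1 normrM.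
have [->|a0] := eqVneq a 0%R; first by rewrite normr0 mul0r mul0e integral_ge0.
rewrite !ge0_integral_lebesgue_rVS1//; last first.
  exact: (measurableT_comp mf (measurable_rV_mulmx _)).
have mF : measurable_fun setT (f \o @rV_cons R n).
  exact: measurableT_comp mf (@measurable_rV_cons R n).
rewrite -[leRHS](ge0_integral_scale a0); last 2 first.
- apply: (measurable_fun_fubini_tonelli_F (m2 := lebesgue_rV n) _ mF) => w.
  exact: f0.
- by move=> t; exact: integral_ge0.
rewrite EFinM -muleA lee_wpmul2l ?lee_fin//.
have mG : measurable_fun [set: (measurableTypeR R * 'rV[R]_n)%type]
    (fun w => f (rV_cons w *m (block_mx a%:M b 0 S : 'M[R]_n.+1))).
  apply: (measurableT_comp mf).
  apply: (measurableT_comp (measurable_rV_mulmx _)).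
  exact: measurable_rV_cons.
rewrite -ge0_integralZl//; last 2 first.
- exact: (measurable_fun_fubini_tonelli_F (m2 := lebesgue_rV n) _ mG).
- by move=> t _; exact: integral_ge0.
apply: ge0_le_integral => //.
- by move=> t _; rewrite mule_ge0 ?lee_fin// integral_ge0.
- apply: emeasurable_funM => //.
  exact: (measurable_fun_fubini_tonelli_F (m2 := lebesgue_rV n) _ mG).
- have mH : measurable_fun [set: (measurableTypeR R * 'rV[R]_n)%type]
    (fun w => f (rV_cons (a * w.1, w.2)%R)).
    apply: (measurableT_comp mF); apply: measurable_fun_pair => //.
    exact: measurable_funM.
  exact: (measurable_fun_fubini_tonelli_F (m2 := lebesgue_rV n) _ mH).
move=> t _.
have mf1 x : measurable_fun [set: 'rV[R]_n] (fun v => f (rV_cons (x, v))).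
  exact: measurable_fun_pair2 mF.
rewrite -[leRHS](@ge0_integral_rV_translation _ (t *: b) (fun v => f (rV_cons ((a * t)%R, v))))//.
apply: le_trans (hS (fun v => f (rV_cons ((a * t)%R, v + t *: b)%R)) _ _) => //; last first.
  exact: (measurableT_comp (mf1 _) (measurable_rV_translation _)).
rewrite lee_wpmul2l ?lee_fin//.
rewrite le_eqVlt; apply/orP; left; apply/eqP; apply: eq_integral => v _.
rewrite (rV_cons_mul_block (t, v))/= mulmx0 !mxE mulr1n addr0 mulrC.
by rewrite addrC.
Qed.

(** This is a shear: for fixed [v] the first coordinate is translated by [v *m c], so it is
    integrated first. *)
Lemma contracts_lebesgue_lblock n (c : 'cV[R]_n) :
  contracts_lebesgue (block_mx 1%:M 0 c 1%:M : 'M[R]_n.+1).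
Proof.
move=> f mf f0.
rewrite (det_lblock (1%:M : 'M[R]_1)) !det1 mulr1 normr1 mul1e.
rewrite !ge0_integral_lebesgue_rVS2//; last first.
  exact: (measurableT_comp mf (measurable_rV_mulmx _)).
have mF : measurable_fun setT (f \o @rV_cons R n).
  exact: measurableT_comp mf (@measurable_rV_cons R n).
rewrite le_eqVlt; apply/orP; left; apply/eqP; apply: eq_integral => v _.
rewrite -[RHS](ge0_integral_translation ((v *m c) ord0 ord0))//; last first.
  exact: measurable_fun_pair1 mF.
apply: eq_integral => t _; rewrite (rV_cons_mul_block (t, v))/=.
by rewrite mulmx1 scaler0 add0r mxE mulr1n mulr1.
Qed.

(** Gaussian elimination, by induction on the dimension: every nonsingular matrix is reduced to
    block triangular factors, whose lower right block is handled by the induction hypothesis. *)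
Lemma lebesgue_rV_contraction n (A : 'M[R]_n) : contracts_lebesgue A.
Proof.
elim: n A => [|n IH] A.
  move=> f mf f0; rewrite det_mx00 normr1 mul1e !integral_lebesgue_rV0.
  by rewrite mul0mx.
(* A nonzero pivot [a] allows a block LU factorization with the Schur complement as last block. *)
have pivot (B : 'M[R]_(1 + n)) : B ord0 ord0 != 0%R -> contracts_lebesgue B.
  move=> B0; set a := B ord0 ord0 in B0.
  pose c := a^-1 *: dlsubmx B.
  have -> : B = block_mx 1%:M 0 c 1%:M *m
      block_mx a%:M (ursubmx B) 0 (drsubmx B - c *m ursubmx B).
    rewrite mulmx_block !mul1mx !mul0mx !addr0 [X in block_mx _ _ _ X]addrC subrK.
    rewrite -[LHS]submxK; congr block_mx.
      apply/matrixP => i j; rewrite !ord1 !mxE /a; congr (B _ _); exact/val_inj.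
    by rewrite /c mul_mx_scalar scalerA divff// scale1r.
  apply: contracts_lebesgue_mul; first exact: contracts_lebesgue_lblock.
  exact: contracts_lebesgue_ublock.
have [A0|] := eqVneq (A ord0 ord0) 0%R; last exact: pivot.
(* If the corner entry vanishes but the first column does not, [E 1] adds a row with nonzero first
   entry to the first row; [E (-1)] undoes this. *)
have [[i Ai]|Ai] := pselect (exists i, A (lift ord0 i) ord0 != 0%R).
  pose E s : 'M[R]_(1 + n) := block_mx 1%:M (s *: delta_mx ord0 i) 0 1%:M.
  have EE : E (-1)%R *m E 1%R = 1%:M.
    rewrite mulmx_block !mul1mx !mul0mx !mulmx0 !mulmx1 add0r !addr0.
    rewrite -scalerDl subrr scale0r add0r.
    exact/esym/(@scalar_mx_block R 1 n 1%R).
  have -> : A = E (-1)%R *m (E 1%R *m A) by rewrite mulmxA EE mul1mx.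
  apply: contracts_lebesgue_mul; first exact: contracts_lebesgue_ublock.
  apply: pivot.
  rewrite mxE (bigD1 ord0)//= (bigD1 (lift ord0 i))//= A0 mulr0 add0r.
  rewrite big1 ?addr0; last first.
    move=> j; case: (unliftP ord0 j) => [k ->|->]; last by rewrite eqxx.
    move=> /andP[_ ki].
    have -> : lift ord0 k = rshift 1 k :> 'I_(1 + n) by exact/val_inj.
    have -> : ord0 = lshift n (ord0 : 'I_1) :> 'I_(1 + n) by exact/val_inj.
    rewrite block_mxEur !mxE eqxx/= (_ : k == i = false) ?mulr0 ?mul0r//.
    by apply: contraNF ki => /eqP ->.
  have -> : (E 1%R) ord0 (lift ord0 i) = 1%R.
    have -> : lift ord0 i = rshift 1 i :> 'I_(1 + n) by exact/val_inj.
    have -> : ord0 = lshift n (ord0 : 'I_1) :> 'I_(1 + n) by exact/val_inj.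
    by rewrite block_mxEur !mxE !eqxx mulr1.
  by rewrite mul1r.
(* The first column is zero here, so the determinant is zero. *)
move=> f mf f0.
suff -> : \det A = 0%R by rewrite normr0 mul0e integral_ge0.
rewrite (expand_det_col _ ord0) big1// => j _.
case: (unliftP ord0 j) => [i ->|->]; last by rewrite A0 mul0r.
have [->|Ai0] := eqVneq (A (lift ord0 i) ord0) 0%R; first by rewrite mul0r.
by exfalso; apply: Ai; exists i.
Qed.

End lebesgue_rV_linear.

(** * Dyadic grids *)

Section dyadic_grid.
Context {R : realType}.

(** The lower corner, in units of [2 ^- j], of the half-open dyadic cube of that side containing
    [x]. *)
Definition dyadic n (j : nat) (x : 'rV[R]_n) : 'rV[int]_n :=
  \row_i Num.floor (2 ^+ j * x ord0 i)%R.

(** There are countably many cubes and each is a box, so [S] may be arbitrary. Consequently any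
    function of the cube index is measurable. *)
Lemma measurable_preimage_dyadic n j (S : set 'rV[int]_n) :
  measurable (dyadic j @^-1` S : set 'rV[R]_n).
Proof.
rewrite (_ : _ @^-1` _ =
    \bigcup_q ([set x : 'rV[R]_n | S q] `&` [set x | dyadic j x = q])).
  apply: countable_bigcupT_measurable; first exact: countableP.
  move=> q; have [Sq|Sq] := pselect (S q); last first.
    by rewrite (_ : _ `&` _ = set0)//; apply/seteqP; split => // x [].
  rewrite (_ : _ `&` _ = \bigcap_(i in [set: 'I_n])
      [set x : 'rV[R]_n | Num.floor (2 ^+ j * x ord0 i)%R == q ord0 i]).
    apply: fin_bigcap_measurable => [|i _]; first exact: finite_finset.
    have m2 : measurable_fun [set: 'rV[R]_n] (fun x : 'rV[R]_n => 2 ^+ j * x ord0 i)%R.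
      by apply: measurable_funM => //; exact: measurable_coord_rV.
    rewrite (_ : mkset _ = (fun x : 'rV[R]_n => 2 ^+ j * x ord0 i)%R @^-1`
      `[ (q ord0 i)%:~R, (q ord0 i + 1)%:~R [%classic).
      by rewrite -[X in measurable X]setTI; exact: m2.
    by apply/seteqP; split => x /=; rewrite in_itv/= floor_eq.
  apply/seteqP; split => [x [_ /= <-] i _ /=|x h]; first by rewrite mxE.
  by split=> //=; apply/rowP => i; rewrite mxE; exact/eqP/h.
by apply/seteqP; split => [x Sx|x [q _ [/= Sq ->]]//]; exists (dyadic j x).
Qed.

Lemma measurable_fun_dyadic n j d (T : measurableType d) (phi : 'rV[int]_n -> T) :
  measurable_fun [set: 'rV[R]_n] (phi \o dyadic j).
Proof.
by move=> _ Y _; rewrite setTI; exact: (measurable_preimage_dyadic j (phi @^-1` Y)).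
Qed.

Lemma dyadic_coordP n j (x y : 'rV[R]_n) : dyadic j x = dyadic j y <->
  forall i, Num.floor (2 ^+ j * x ord0 i)%R = Num.floor (2 ^+ j * y ord0 i)%R.
Proof.
split=> [/rowP h i|h]; first by have := h i; rewrite !mxE.
by apply/rowP => i; rewrite !mxE.
Qed.

(** The norm is the maximum norm. Positivity of [e] settles the case [n = 0], where the right-hand
    side is vacuous. *)
Lemma norm_rV_lt n (x : 'rV[R]_n) (e : R) : (0 < e)%R ->
  (`|x| < e)%R <-> (forall i, `|x ord0 i| < e)%R.
Proof.
move=> e0.
have -> : (`|x| < e)%R <-> ball (0%R : 'rV[R]_n) e x.
  by rewrite mx_norm_ball /ball_ /= sub0r normrN.
split=> [[_ h] i|h].
  by have := h ord0 i; rewrite mxE -ball_normE /= sub0r normrN.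
split=> // i j; rewrite mxE -ball_normE /= sub0r normrN (ord1 i).
exact: h.
Qed.

Lemma dyadic_dist n j (x y : 'rV[R]_n) :
  dyadic j x = dyadic j y -> (`|x - y| < (2 ^+ j)^-1)%R.
Proof.
move=> /dyadic_coordP h; have j0 : (0 < 2 ^+ j :> R)%R by rewrite exprn_gt0.
apply/norm_rV_lt; first by rewrite invr_gt0.
move=> i; rewrite !mxE -(ltr_pM2l j0) divff ?gt_eqF//.
rewrite -{1}(gtr0_norm j0) -normrM mulrBr.
have := h i; have := floor_itv (2 ^+ j * x ord0 i)%R.
have := floor_itv (2 ^+ j * y ord0 i)%R.
set a := (2 ^+ j * x ord0 i)%R; set b := (2 ^+ j * y ord0 i)%R.
move=> /andP[b1 b2] /andP[a1 a2] ab; rewrite -{}ab in b1 b2.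
rewrite intrD in a2 b2; rewrite ltr_norml; apply/andP; split; lra.
Qed.

(** This links the topology to the coordinate sigma-algebra: [f] is the pointwise limit of its
    values at the lower corners of the dyadic cubes, and these approximations are constant on each
    cube. *)
Lemma measurable_fun_continuous_rV n (f : 'rV[R]_n -> R) :
  continuous f -> measurable_fun [set: 'rV[R]_n] f.
Proof.
move=> cf.
pose corner j (q : 'rV[int]_n) : 'rV[R]_n := \row_i ((q ord0 i)%:~R / 2 ^+ j)%R.
apply: (measurable_fun_cvg (h := fun j => f \o corner j \o dyadic j)).
  by move=> j; exact: (measurable_fun_dyadic j (f \o corner j)).
move=> x _.
suff cx : corner j (dyadic j x) @[j --> \oo] --> x.
  exact: (cvg_comp (fun j => corner j (dyadic j x)) f cx (cf x)).
apply/cvgrPdist_lt => e e0; near=> j.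
have j0 : (0 < 2 ^+ j :> R)%R by rewrite exprn_gt0.
apply: lt_trans (_ : _ < (2 ^+ j)^-1)%R _; last first.
  near: j.
  have : ((2^-1 : R) ^+ j @[j --> \oo] --> 0)%R.
    by apply: cvg_expr; rewrite ger0_norm ?invf_lt1// ltr1n.
  move=> /cvgrPdist_lt /(_ _ e0); apply: filterS => j.
  by rewrite sub0r normrN ger0_norm ?exprn_ge0// exprVn.
(* A point and the lower corner of its cube have the same index, since the scaled corner is already
   an integer vector. *)
apply: dyadic_dist; apply/dyadic_coordP => i; rewrite !mxE mulrCA divff ?gt_eqF//.
by rewrite mulr1 intrKfloor.
Unshelve. all: by end_near. Qed.

End dyadic_grid.

(** * Dyadic cubes and their shrunken copies *)

Section dyadic_cells.
Context {R : realType}.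

(** The cube of index [q] with the fraction [t] of its side removed at both ends of each coordinate;
    [t = 0] is the whole cube. *)
Definition cell n (j : nat) (t : R) (q : 'rV[int]_n) : set 'rV[R]_n :=
  [set y | forall i, `[((q ord0 i)%:~R + t) / 2 ^+ j,
                       ((q ord0 i)%:~R + 1 - t) / 2 ^+ j[%classic%R (y ord0 i)].

Lemma measurable_cell n j t (q : 'rV[int]_n) : measurable (cell j t q).
Proof.
rewrite (_ : cell j t q = \bigcap_(i in [set: 'I_n]) ((fun x : 'rV[R]_n => x ord0 i) @^-1`
      `[((q ord0 i)%:~R + t) / 2 ^+ j,
                       ((q ord0 i)%:~R + 1 - t) / 2 ^+ j[%classic%R)).
  apply: fin_bigcap_measurable => [|i _]; first exact: finite_finset.
  by rewrite -[X in measurable X]setTI; exact: (measurable_coord_rV i).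
by apply/seteqP; split => x h i => [_|]; exact: h.
Qed.

Lemma lebesgue_rV_cell n j (t : R) (q : 'rV[int]_n) : (0 <= t < 2^-1)%R ->
  lebesgue_rV n (cell j t q) = (((1 - 2 * t) / 2 ^+ j) ^+ n)%:E.
Proof.
move=> /andP[t0 t1]; have j0 : (0 < 2 ^+ j :> R)%R by rewrite exprn_gt0.
rewrite (lebesgue_rV_box (A := fun i => `[((q ord0 i)%:~R + t) / 2 ^+ j,
  ((q ord0 i)%:~R + 1 - t) / 2 ^+ j[%classic%R))//.
under eq_bigr => i _.
  rewrite lebesgue_measure_itv/= lte_fin ltr_pM2r ?invr_gt0//.
  rewrite (_ : (_ + t < _ + 1 - t)%R); last lra.
  rewrite -EFinD (_ : (_ / _ - _ / _)%R = ((1 - 2 * t) / 2 ^+ j)%R); last first.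
    by field; rewrite gt_eqF.
  over.
by rewrite prodEFin prodr_const card_ord.
Qed.

Lemma cell_dyadic n j (t : R) (x y : 'rV[R]_n) : (0 <= t)%R ->
  cell j t (dyadic j x) y -> dyadic j y = dyadic j x.
Proof.
move=> t0 h; have j0 : (0 < 2 ^+ j :> R)%R by rewrite exprn_gt0.
apply/dyadic_coordP => i; apply: floor_def.
have := h i; rewrite /= in_itv/= mxE ler_pdivrMr// ltr_pdivlMr// mulrC intrD.
by move=> /andP[a b]; apply/andP; split; lra.
Qed.

Lemma dyadic_cell n j (x y : 'rV[R]_n) :
  dyadic j y = dyadic j x -> cell j 0 (dyadic j x) y.
Proof.
move=> /dyadic_coordP h i; have j0 : (0 < 2 ^+ j :> R)%R by rewrite exprn_gt0.
rewrite /= in_itv/= mxE ler_pdivrMr// ltr_pdivlMr// addr0 subr0 -h.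
have := floor_itv (2 ^+ j * y ord0 i)%R.
by rewrite intrD mulrC.
Qed.

(** Points of the shrunken cube keep a margin [t / 2 ^+ j] from the boundary. This margin will
    absorb the linearization error of [h]. *)
Lemma cell_near n j (t : R) (x y z : 'rV[R]_n) : (0 < t)%R ->
  cell j t (dyadic j x) y -> (`|z - y| < t / 2 ^+ j)%R -> dyadic j z = dyadic j x.
Proof.
move=> t0 h; have j0 : (0 < 2 ^+ j :> R)%R by rewrite exprn_gt0.
move=> /norm_rV_lt hz; have {}hz := hz (divr_gt0 t0 j0).
apply: (@cell_dyadic _ _ 0) => // i; have := h i; have := hz i.
rewrite !mxE ltr_pdivlMr// -[X in (_ * X)%R](gtr0_norm j0) -normrM.
rewrite mulrBl ltr_norml => /andP[a b].
rewrite /= !in_itv/= !ler_pdivrMr// !ltr_pdivlMr// => /andP[c d].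
by apply/andP; split; lra.
Qed.

End dyadic_cells.

(** * Measurability of the Jacobian of a differentiable map *)

Section jacobian_measurable.
Context {R : realType}.

(** The derivative need not be continuous, but each entry is a pointwise limit of difference
    quotients, which are continuous in [x]. *)
Lemma measurable_fun_jacobian n p (f : 'rV[R]_n -> 'rV[R]_p) i j :
  (forall x, differentiable f x) ->
  measurable_fun [set: 'rV[R]_n] (fun x => ('J f x) i j).
Proof.
move=> df.
pose v : 'rV[R]_n := delta_mx ord0 i.
pose s k : R := (k.+1%:R^-1)%R.
(* The derivative is a limit over punctured neighbourhoods of 0, which the nonzero steps [s k]
   respect. *)
have s0 : s k @[k --> \oo] --> (0 : R)^'%R.
  move=> A /= hA; have := @cvg_harmonic R _ hA; rewrite /nbhs /=.
  by apply: filterS => m; apply; rewrite /harmonic /= invr_eq0 pnatr_eq0.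
have cf : continuous f by move=> x; exact: differentiable_continuous.
apply: (measurable_fun_cvg
    (h := fun k x => ((s k)^-1 * (f (s k *: v + x) ord0 j - f x ord0 j))%R)).
  move=> m; apply: measurable_funM => //.
  apply: measurable_funB; apply: measurable_fun_continuous_rV => x.
    apply: (cvg_comp (fun x => f (s m *: v + x)%R) (fun y : 'rV[R]_p => y ord0 j)
      _ (@coord_continuous _ _ _ _ _ _)).
    apply: (cvg_comp _ f _ (cf _)).
    exact: (cvgD (cvg_cst _) (@cvg_id _ (nbhs x))).
  exact: (cvg_comp f (fun y : 'rV[R]_p => y ord0 j) (cf x)
    (@coord_continuous _ _ _ _ _ _)).
move=> x _.
have -> : ('J f x) i j = ('D_v f x) ord0 j.
  by rewrite deriveEjacobian// -[v]/(delta_mx 0%R i) -rowE [RHS]mxE.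
have dv : derivable f x v by exact: diff_derivable.
have := cvg_comp _ _ s0 dv.
move=> /(fun h => cvg_comp _ (fun y : 'rV[R]_p => y ord0 j) h (@coord_continuous _ _ _ _ _ _)).
apply: cvg_trans; apply: near_eq_cvg; apply: nearW => k /=.
by rewrite !mxE.
Qed.

Lemma measurable_fun_abs_jacobian k n (g : 'I_k -> 'rV[R]_n -> 'rV[R]_n) d :
  (forall x, differentiable (g d) x) ->
  measurable_fun [set: 'rV[R]_n] (abs_jacobian g d).
Proof.
move=> dg; apply: measurableT_comp => //; rewrite /determinant.
apply: measurable_sum => s; apply: measurable_funM => //.
by apply: measurable_prod => i _; exact: measurable_fun_jacobian.
Qed.

End jacobian_measurable.

(** * The area inequality *)

Lemma le_limn_einf {R : realType} (u : (\bar R)^nat) (a : \bar R) :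
  (\forall j \near \oo, a <= u j) -> a <= limn_einf u.
Proof.
move=> [N _ au]; rewrite limn_einf_lim; apply: lime_ge; first exact: is_cvg_einfs.
near=> p; apply: le_ereal_inf_tmp => _ [q /= pq <-]; apply: au => /=.
by apply: leq_trans pq; near: p; exists N.
Unshelve. all: by end_near. Qed.

Lemma le_of_powers {R : realType} (c : R) (N : nat) (y : \bar R) :
  (forall t : R, (0 < t < 2^-1)%R -> (c * (1 - 2 * t) ^+ N)%:E <= y) -> c%:E <= y.
Proof.
move=> h.
(* Dividing by 3 keeps [t j] below one half already at [j = 0], while it tends to 0. *)
pose t (j : nat) : R := (harmonic j / 3)%R.
have t0 : t j @[j --> \oo] --> (0 : R)%R.
  by rewrite -[X in _ --> X](mul0r (3^-1 : R)%R); apply: cvgMr_tmp; exact: cvg_harmonic.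
have : ((c * (1 - 2 * t j) ^+ N)%:E) @[j --> \oo] --> (c%:E).
  apply/cvg_EFin; first exact: nearW.
  rewrite -[X in _ --> X]mulr1; apply: cvgMl_tmp.
  rewrite -[X in _ --> X](expr1n _ N) -[in X in _ --> X](subr0 1)%R.
  rewrite -[in X in _ --> X](mulr0 2)%R.
  apply: (cvg_comp (fun j => 1 - 2 * t j)%R (fun x => x ^+ N)%R); last exact: exprn_continuous.
  by apply: cvgB; [exact: cvg_cst|exact: cvgMl_tmp].
move=> hc; rewrite -(cvg_lim _ hc)//.
apply: lime_le; first by apply/cvg_ex; eexists; exact: hc.
apply: nearW => j; apply: h; rewrite divr_gt0 ?invr_gt0//=.
apply: le_lt_trans (_ : _ <= 3^-1)%R _; last by rewrite ltf_pV2 ?posrE// ltr_nat.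
by rewrite ler_piMl// /harmonic invf_le1// ler1n.
Qed.

Section area_inequality.
Context {R : realType}.
Variables (n : nat) (g h : 'rV[R]_n -> 'rV[R]_n) (f : 'rV[R]_n -> R).
Hypotheses (hg : cancel g h) (gh : cancel h g).
Hypothesis dg : forall x, differentiable g x.
Hypothesis dh : forall x, differentiable h x.
Hypothesis cf : continuous f.
Hypothesis f0 : forall x, (0 <= f x)%R.

Let same_cell j : set ('rV[R]_n * 'rV[R]_n) :=
  [set w | dyadic j (h w.2) = dyadic j w.1].

(* [\int K j x z dz] is the mean over the dyadic cell of [x] of the image
   under [h] of the measure with density [f]. *)
Let K j (x z : 'rV[R]_n) : R :=
  (\1_(same_cell j) (x, z) * ((2 ^+ j) ^+ n * f z))%R.

Let mf : measurable_fun [set: 'rV[R]_n] f.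
Proof. exact: measurable_fun_continuous_rV. Qed.

Let ch : continuous h.
Proof. by move=> x; exact: differentiable_continuous. Qed.

Let cg : continuous g.
Proof. by move=> x; exact: differentiable_continuous. Qed.

Lemma measurable_fun_continuous_rV_rV p (u : 'rV[R]_n -> 'rV[R]_p) :
  continuous u -> measurable_fun [set: 'rV[R]_n] u.
Proof.
move=> cu; apply: measurable_fun_rV => i; apply: measurable_fun_continuous_rV => x.
exact: (cvg_comp u (fun y : 'rV[R]_p => y ord0 i) (cu x) (@coord_continuous _ _ _ _ _ _)).
Qed.

Let measurable_same_cell j : measurable (same_cell j).
Proof.
rewrite (_ : same_cell j = \bigcup_q (
    ((@fst 'rV[R]_n 'rV[R]_n) @^-1` (dyadic j @^-1` [set q])) `&`
    ((h \o @snd 'rV[R]_n 'rV[R]_n) @^-1` (dyadic j @^-1` [set q])))).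
  apply: countable_bigcupT_measurable; first exact: countableP.
  move=> q; apply: measurableI; rewrite -[X in measurable X]setTI.
    by apply: measurable_fst => //; exact: measurable_preimage_dyadic.
  apply: (measurableT_comp (measurable_fun_continuous_rV_rV ch) measurable_snd) => //.
  exact: measurable_preimage_dyadic.
apply/seteqP; split => [[x z] /= xz|[x z] [q _ [/= xq zq]]].
  by exists (dyadic j x).
by rewrite /same_cell /= xq.
Qed.

Let measurable_K j : measurable_fun setT (fun w => (K j w.1 w.2)%:E).
Proof.
apply/measurable_EFinP; apply: measurable_funM.
  under eq_fun do rewrite -surjective_pairing.
  exact: measurable_indic.
by apply: measurable_funM => //; exact: (measurableT_comp mf).
Qed.

Let K_ge0 j x z : (0 <= K j x z)%R.
Proof. by rewrite /K !mulr_ge0// exprn_ge0// exprn_ge0. Qed.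

(** By Tonelli [x] is integrated first. For fixed [z] it ranges over the cube of [h z], whose volume
    cancels the factor [(2 ^+ j) ^+ n]. *)
Let integral_K j :
  \int[lebesgue_rV n]_x \int[lebesgue_rV n]_z (K j x z)%:E =
  \int[lebesgue_rV n]_z (f z)%:E.
Proof.
rewrite (fubini_tonelli (fun w => (K j w.1 w.2)%:E))//; last first.
  by move=> w; rewrite lee_fin.
apply: eq_integral => z _ /=.
have E x : (K j x z)%:E = ((2 ^+ j) ^+ n * f z)%:E * (\1_(cell j 0 (dyadic j (h z))) x)%:E.
  rewrite -EFinM /K mulrC; congr (_ * _)%:E.
  rewrite !indicE; congr (nat_of_bool _)%:R; apply/idP/idP; rewrite !inE /same_cell /=.
    by move=> /esym; exact: dyadic_cell.
  by move=> hx; apply/esym; exact: cell_dyadic (lexx _) hx.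
under eq_integral do rewrite E.
rewrite ge0_integralZl//; last 2 first.
- by apply/measurable_EFinP; apply: measurable_indic; exact: measurable_cell.
- by rewrite lee_fin mulr_ge0// exprn_ge0// exprn_ge0.
rewrite integral_indic//; last exact: measurable_cell.
rewrite setIT [X in _ * X]lebesgue_rV_cell; last by rewrite lexx/= invr_gt0.
rewrite mulr0 subr0 div1r -EFinM exprVn mulrAC divff ?mul1r//.
Qed.

Let jacobianE x v : v *m 'J g x = 'd g x v.
Proof. by rewrite -deriveEjacobian// deriveE. Qed.

(** The chain rule for [h \o g = id]: the differential of [h] at [g x] inverts the linear part of
    [g] at [x]. *)
Let diff_inverse x v : ('d h (g x) (v *m 'J g x) = v)%R.
Proof.
have idE : 'd id x v = v :> 'rV[R]_n.
  by rewrite diff_val.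
have := @diff_comp _ _ _ _ g h x (dg x) (dh (g x)).
have -> : h \o g = id by apply/funext => y /=; exact: hg.
by move=> /(congr1 (fun F => F v)) E; rewrite jacobianE; exact: etrans (esym E) idE.
Qed.

Let inverse_linearization x (t : R) : (0 < t)%R ->
  \forall v \near (0%R : 'rV[R]_n),
    (`|h (v *m 'J g x + g x) - (x + v)| <= t * `|v|)%R.
Proof.
move=> t0.
have /linear_bounded_continuous/linear_boundedP := diff_continuous (dg x).
move=> /pinfty_ex_gt0[M M0 hM].
have [_ /eqaddoP] := (diff_locallyP (g x) h).1 (dh (g x)).
(* [M] bounds the linear part of [g], so an error of at most [t / M] times the norm of [v *m 'J g x]
   is at most [t] times the norm of [v]. *)
move=> /(_ (t / M)%R (divr_gt0 t0 M0)) hd.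
have cJ : (v *m 'J g x) @[v --> (0%R : 'rV[R]_n)] --> (0%R : 'rV[R]_n).
  under eq_fun do rewrite jacobianE.
  have cdg : continuous ('d g x) by exact: diff_continuous.
  by have := cdg 0%R; rewrite /continuous_at linear0.
refine (@filterS _ (nbhs (0%R : 'rV[R]_n)) _ _ _ _ (cJ _ hd)) => v /=.
rewrite !fctE /= diff_inverse hg opprD addrA => /le_trans; apply.
by rewrite jacobianE mulrAC -mulrA ler_pM2l// ler_pdivrMr// mulrC hM.
Qed.

(** Restrict to points [v *m 'J g x + g x] with [v + x] in the cube shrunk by [t]: [h] sends them
    into the cube of [x], and [f] has lost at most the relative amount [2 * t] there. The volume of
    the shrunken cube yields [n] factors [1 - 2 * t], and the variation of [f] yields one more. *)
Let K_lower_bound x (t : R) : (0 < t < 2^-1)%R ->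
  \forall j \near \oo, (`| \det ('J g x) | * f (g x) * (1 - 2 * t) ^+ n.+1)%:E <=
    \int[lebesgue_rV n]_z (K j x z)%:E.
Proof.
move=> /andP[t0 t1].
(* If [f] vanishes at [g x] the bound is trivial; otherwise the relative tolerance below is
   positive. *)
have [fgx|fgx] := eqVneq (f (g x)) 0%R.
  apply: nearW => j; rewrite fgx mulr0 mul0r; apply: integral_ge0 => z _.
  by rewrite lee_fin.
have {}fgx : (0 < f (g x))%R by rewrite lt_neqAle eq_sym fgx/=.
have e1 : (0 < f (g x) * (2 * t))%R by rewrite !mulr_gt0.
have cfg : {for x, continuous (f \o g)} by apply: continuous_comp; [exact: cg|exact: cf].
have /nbhs_ballP[d1 /= d10 hd1] : \forall y \near x,
    (`|f (g x) - f (g y)| < f (g x) * (2 * t))%R.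
  exact: cvgr_dist_lt cfg _ e1.
have := inverse_linearization x t0; rewrite -nbhs_nearE => /nbhs_ballP[d2 /= d20 hd2].
have small : \forall j \near \oo, ((2 ^+ j)^-1 < Num.min d1 d2 :> R)%R.
  have : ((2^-1 : R) ^+ j @[j --> \oo] --> 0)%R.
    by apply: cvg_expr; rewrite ger0_norm ?invf_lt1// ltr1n.
  have d0 : (0 < Num.min d1 d2)%R by rewrite lt_min d10.
  move=> /cvgrPdist_lt /(_ _ d0); apply: filterS => j.
  by rewrite sub0r normrN ger0_norm ?exprn_ge0// exprVn.
near=> j.
have /andP[j1 j2] : ((2 ^+ j)^-1 < d1)%R && ((2 ^+ j)^-1 < d2)%R.
  by rewrite -lt_min; near: j.
have mKx : measurable_fun [set: 'rV[R]_n] (fun z => (K j x z)%:E).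
  exact: (measurable_fun_pair2 x (measurable_K j)).
have mKgx : measurable_fun [set: 'rV[R]_n] (fun z => (K j x (z + g x)%R)%:E).
  exact: (measurableT_comp mKx (measurable_rV_translation _)).
(* Centre [z] at [g x], then substitute the linear part of [g]; the determinant cancels from both
   sides. *)
rewrite -(@ge0_integral_rV_translation _ _ (g x))//; last by move=> z; rewrite lee_fin.
apply: le_trans (lebesgue_rV_contraction ('J g x) mKgx _); last by move=> z; rewrite lee_fin.
rewrite -mulrA EFinM lee_wpmul2l ?lee_fin//.
set B := cell j t (dyadic j x).
have mB : measurable B by exact: measurable_cell.
(* [c] bounds the integrand from below on [B], and its product with the volume of [B] is exactly the
   required quantity. *)
pose c := ((2 ^+ j) ^+ n * (f (g x) * (1 - 2 * t)))%R.
have c0 : (0 <= c)%R.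
  rewrite /c mulr_ge0 ?exprn_ge0 ?exprn_ge0// mulr_ge0 ?(ltW fgx)//; lra.
rewrite (_ : (f (g x) * _)%:E = c%:E * lebesgue_rV n B); last first.
  rewrite lebesgue_rV_cell ?(ltW t0)// -EFinM /c exprS expr_div_n; congr EFin; field.
  by rewrite expf_neq0// expf_neq0// pnatr_eq0.
have -> : lebesgue_rV n B = \int[lebesgue_rV n]_v (\1_B v)%:E.
  by rewrite integral_indic// setIT.
rewrite -ge0_integralZl//; last first.
  by apply/measurable_EFinP; exact: measurable_indic.
rewrite -[leLHS](@ge0_integral_rV_translation _ _ x)//; last 2 first.
- by apply: measurable_funeM; apply/measurable_EFinP; exact: measurable_indic.
- by move=> v; rewrite mule_ge0// lee_fin.
apply: ge0_le_integral => //.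
- by move=> v _; rewrite mule_ge0// lee_fin.
- apply: measurable_funeM; apply/measurable_EFinP.
  have mI : measurable_fun setT (\1_B : 'rV[R]_n -> R) by exact: measurable_indic.
  exact: (measurableT_comp mI (measurable_rV_translation _)).
- exact: (measurableT_comp mKgx (measurable_rV_mulmx _)).
move=> v _; rewrite -EFinM lee_fin indicE.
have [|] := boolP ((v + x)%R \in B); last by rewrite mulr0.
rewrite inE mulr1 => vxB.
have vx : dyadic j (v + x)%R = dyadic j x by exact: cell_dyadic (ltW t0) vxB.
have vj : (`|v| < (2 ^+ j)^-1)%R by have := dyadic_dist vx; rewrite addrK.
have hv : (`|h (v *m 'J g x + g x) - (v + x)| < t / 2 ^+ j)%R.
  have : (`|h (v *m 'J g x + g x) - (x + v)| <= t * `|v|)%R.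
    by apply: hd2; rewrite -ball_normE /= sub0r normrN (lt_trans vj).
  by rewrite (addrC x) => /le_lt_trans; apply; rewrite ltr_pM2l.
have cellE := cell_near t0 vxB hv.
rewrite /K indicE mem_set//= mul1r /c ler_wpM2l ?exprn_ge0 ?exprn_ge0//.
(* Since [g] undoes [h], the value of [f] is one of [f \o g] at a point in the cube of [x], where
   continuity at [x] applies. *)
have := hd1 (h (v *m 'J g x + g x)) _.
rewrite -ball_normE /= gh distrC => /(_ (lt_trans (dyadic_dist cellE) j1)).
rewrite ltr_distlC => /andP[+ _] => /ltW.
by apply: le_trans; rewrite mulrBr mulr1.
Unshelve. all: by end_near. Qed.

Theorem area_inequality :
  \int[lebesgue_rV n]_x (`| \det ('J g x) | * f (g x))%:E <=
  \int[lebesgue_rV n]_z (f z)%:E.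
Proof.
pose F j x := \int[lebesgue_rV n]_z (K j x z)%:E.
have mF j : measurable_fun [set: 'rV[R]_n] (F j).
  apply: (measurable_fun_fubini_tonelli_F (m2 := lebesgue_rV n) _ (measurable_K j)) => w.
  by rewrite lee_fin.
have F0 j x : 0 <= F j x by apply: integral_ge0 => z _; rewrite lee_fin.
have lF x : (`| \det ('J g x) | * f (g x))%:E <= limn_einf (F^~ x).
  (* The threshold in [j] depends on [t], so the lower limit in [j] is taken before [t] tends to
     0. *)
  by apply: (@le_of_powers _ _ n.+1) => t t01; apply: le_limn_einf; exact: K_lower_bound.
apply: (@le_trans _ _ (\int[lebesgue_rV n]_x limn_einf (F^~ x))).
  apply: ge0_le_integral => //.
  - by move=> x _; rewrite lee_fin mulr_ge0.
  - apply/measurable_EFinP; apply: measurable_funM.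
      exact: (@measurable_fun_abs_jacobian _ 1 n (fun=> g) ord0).
    exact: measurableT_comp mf (measurable_fun_continuous_rV_rV cg).
  - under eq_fun do rewrite /limn_einf.
    by apply: measurableT_comp => //; apply: measurable_fun_limn_esup => j; exact: measurableT_comp.
apply: le_trans (fatou _ measurableT mF (fun j x _ => F0 j x)) _.
under eq_fun do rewrite integral_K.
by rewrite (cvg_limn_einf_sup (@cvg_cst _ _ _ \oo _)).
Qed.

End area_inequality.

(** * Gaussian noise *)

Section gaussian_noise.
Context {R : realType}.

Lemma continuous_bigprod (T : topologicalType) (I : Type) (s : seq I)
    (F : I -> T -> R) :
  (forall i, continuous (F i)) -> continuous (fun x => \prod_(i <- s) F i x)%R.
Proof.
move=> cF; elim: s => [|i s IH] x.
  by under eq_fun do rewrite big_nil; exact: cvg_cst.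
under eq_fun do rewrite big_cons.
by apply: cvgM; [exact: cF|exact: IH].
Qed.

Lemma continuous_gaussian_subr n (s2 : R) (w : 'rV[R]_n) : (0 < s2)%R ->
  continuous (fun z : 'rV[R]_n => gaussian s2 (w - z)%R).
Proof.
move=> s0; apply: continuous_bigprod => i x.
apply: (cvg_comp (fun z : 'rV[R]_n => (w - z : 'rV[R]_n)%R ord0 i)); last first.
  by apply: continuous_normal_pdf; rewrite gt_eqF// sqrtr_gt0.
under eq_fun do rewrite !mxE.
rewrite !mxE.
exact: (@cvgB R R^o _ (nbhs x) _ (fun=> w ord0 i) (fun z : 'rV[R]_n => z ord0 i)
  _ _ (cvg_cst _) (@coord_continuous _ _ _ _ _ x)).
Qed.

Lemma gaussian_ge0 n (s2 : R) (e : 'rV[R]_n) : (0 <= gaussian s2 e)%R.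
Proof. by apply: prodr_ge0 => i _; exact: normal_pdf_ge0. Qed.

Lemma measurable_gaussian_comp n (s2 : R) d (T : measurableType d)
    (f : T -> 'rV[R]_n) : measurable_fun [set: T] f ->
  measurable_fun [set: T] (fun t => gaussian s2 (f t)).
Proof.
move=> mf; apply: measurable_prod => i _.
apply: (measurableT_comp (measurable_normal_pdf _ _)).
exact: (measurableT_comp (measurable_coord_rV i) mf).
Qed.

Lemma measurable_gaussian n (s2 : R) :
  measurable_fun [set: 'rV[R]_n] (@gaussian R n s2).
Proof. exact: measurable_gaussian_comp. Qed.

Lemma gaussian_rV_cons n (s2 : R) (p : R * 'rV[R]_n) :
  gaussian s2 (rV_cons p) = (normal_pdf 0 (Num.sqrt s2) p.1 * gaussian s2 p.2)%R.
Proof.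
rewrite /gaussian big_ord_recl rV_consE0; congr (_ * _)%R.
by apply: eq_bigr => i _; rewrite rV_consES.
Qed.

Lemma integral_gaussian n (s2 : R) :
  \int[lebesgue_rV n]_e (gaussian s2 e)%:E = 1.
Proof.
elim: n => [|n IH].
  by rewrite integral_lebesgue_rV0 /gaussian big_ord0.
rewrite ge0_integral_lebesgue_rVS1//; last 2 first.
- by apply/measurable_EFinP; exact: measurable_gaussian.
- by move=> e; rewrite lee_fin gaussian_ge0.
rewrite -[RHS](@integral_normal_pdf R 0 (Num.sqrt s2)); apply: eq_integral => t _.
under eq_integral do rewrite gaussian_rV_cons EFinM.
rewrite /= ge0_integralZl//.
- by rewrite IH mule1.
- by apply/measurable_EFinP; exact: measurable_gaussian.
- by move=> e _; rewrite lee_fin gaussian_ge0.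
- by rewrite lee_fin normal_pdf_ge0.
Qed.

Lemma gaussianN n (s2 : R) (e : 'rV[R]_n) : (0 < s2)%R ->
  gaussian s2 (- e)%R = gaussian s2 e.
Proof.
move=> s0; apply: eq_bigr => i _; rewrite mxE !normal_pdfE ?gt_eqF ?sqrtr_gt0//.
by rewrite /normal_fun !subr0 sqrrN.
Qed.

Lemma gaussian_ub n (s2 : R) (e : 'rV[R]_n) : (0 < s2)%R ->
  (gaussian s2 e <= normal_peak (Num.sqrt s2) ^+ n)%R.
Proof.
move=> s0; rewrite -[X in (_ ^+ X)%R]card_ord -prodr_const.
apply: ler_prod => i _; rewrite normal_pdf_ge0/= normal_pdf_ub//.
by rewrite gt_eqF// sqrtr_gt0.
Qed.

Lemma measurable_gaussian_sub n (s2 : R) :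
  measurable_fun [set: ('rV[R]_n * 'rV[R]_n)%type]
    (fun v : ('rV[R]_n * 'rV[R]_n)%type => gaussian s2 (v.1 - v.2)%R).
Proof.
apply: measurable_gaussian_comp.
apply: measurable_fun_rV => i; under eq_fun do rewrite !mxE.
apply: measurable_funB.
  exact: (measurableT_comp (measurable_coord_rV i) measurable_fst).
exact: (measurableT_comp (measurable_coord_rV i) measurable_snd).
Qed.

Lemma integral_gaussian_subl n (s2 : R) (z : 'rV[R]_n) :
  \int[lebesgue_rV n]_w (gaussian s2 (w - z))%:E = 1.
Proof.
rewrite (@ge0_integral_rV_translation _ _ (- z)%R (fun v => (gaussian s2 v)%:E)).
- exact: integral_gaussian.
- by apply/measurable_EFinP; exact: measurable_gaussian.
- by move=> e; rewrite lee_fin gaussian_ge0.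
Qed.

Lemma integral_gaussian_subr n (s2 : R) (w : 'rV[R]_n) : (0 < s2)%R ->
  \int[lebesgue_rV n]_z (gaussian s2 (w - z))%:E = 1.
Proof.
move=> s0; rewrite -(integral_gaussian_subl s2 w); apply: eq_integral => z _.
by rewrite -gaussianN// opprB.
Qed.

(** The substitution [w = z + e]. *)
Lemma integral_gaussian_shift n (s2 : R) (z : 'rV[R]_n) (F : 'rV[R]_n -> \bar R) :
  measurable_fun [set: 'rV[R]_n] F -> (forall w, 0 <= F w) ->
  \int[lebesgue_rV n]_e ((gaussian s2 e)%:E * F (z + e)%R) =
  \int[lebesgue_rV n]_w ((gaussian s2 (w - z))%:E * F w).
Proof.
move=> mF F0.
have mG : measurable_fun [set: 'rV[R]_n] (fun w => (gaussian s2 (w - z))%:E * F w).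
  apply: emeasurable_funM; last exact: mF.
  apply/measurable_EFinP; apply: measurable_gaussian_comp.
  exact: measurable_rV_translation.
have G0 w : 0 <= (gaussian s2 (w - z))%:E * F w.
  by rewrite mule_ge0// lee_fin gaussian_ge0.
rewrite -[RHS](ge0_integral_rV_translation z mG G0).
by apply: eq_integral => e _; rewrite addrK addrC.
Qed.

(** * Convolution of a density with the Gaussian *)

Section noisy.
Variables (n : nat) (s2 : R) (q : 'rV[R]_n -> R).
Hypothesis s0 : (0 < s2)%R.
Hypothesis mq : measurable_fun [set: 'rV[R]_n] q.
Hypothesis q0 : forall z, (0 <= q z)%R.
Hypothesis q1 : \int[lebesgue_rV n]_z (q z)%:E = 1.

Let measurable_kernel : measurable_fun [set: ('rV[R]_n * 'rV[R]_n)%type]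
  (fun v => (q v.2 * gaussian s2 (v.1 - v.2))%R%:E).
Proof.
apply/measurable_EFinP; apply: measurable_funM.
  exact: (measurableT_comp mq measurable_snd).
exact: measurable_gaussian_sub.
Qed.

(** The Gaussian is bounded by its peak and [q] has mass 1, so the convolution is finite at every
    point and the real-valued integral never falls back to its default value. *)
Lemma EFin_noisy w :
  (noisy s2 q w)%:E = \int[lebesgue_rV n]_z (q z * gaussian s2 (w - z))%:E.
Proof.
rewrite /noisy fineK// ge0_fin_numE; last first.
  by apply: integral_ge0 => z _; rewrite lee_fin mulr_ge0// gaussian_ge0.
pose M := (normal_peak (Num.sqrt s2) ^+ n)%R.
have M0 : (0 <= M)%R by rewrite exprn_ge0// normal_peak_ge0.
apply: (@le_lt_trans _ _ (\int[lebesgue_rV n]_z (M%:E * (q z)%:E))).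
  apply: ge0_le_integral => //.
  - by move=> z _; rewrite lee_fin mulr_ge0// gaussian_ge0.
  - exact: (measurable_fun_pair2 w measurable_kernel).
  - by apply: measurable_funeM; exact/measurable_EFinP.
  by move=> z _; rewrite -EFinM lee_fin mulrC ler_wpM2r// gaussian_ub.
rewrite ge0_integralZl ?q1 ?mule1 ?ltry//; first exact/measurable_EFinP.
by move=> z _; rewrite lee_fin.
Qed.

Lemma noisy_ge0 w : (0 <= noisy s2 q w)%R.
Proof.
by apply: Rintegral_ge0 => z _; rewrite mulr_ge0// gaussian_ge0.
Qed.

Lemma measurable_noisy : measurable_fun [set: 'rV[R]_n] (noisy s2 q).
Proof.
apply/measurable_EFinP; rewrite (_ : _ \o _ = fun w =>
    \int[lebesgue_rV n]_z (q z * gaussian s2 (w - z))%:E); last first.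
  by apply/funext => w /=; exact: EFin_noisy.
apply: (measurable_fun_fubini_tonelli_F (m2 := lebesgue_rV n) _ measurable_kernel) => v.
by rewrite lee_fin mulr_ge0// gaussian_ge0.
Qed.

(** This says that [noisy s2 q] is the density of the sum of a latent of density [q] and independent
    noise; it follows from the shift and Tonelli. *)
Lemma integral_noisy (F : 'rV[R]_n -> \bar R) :
  measurable_fun [set: 'rV[R]_n] F -> (forall w, 0 <= F w) ->
  \int[lebesgue_rV n]_z ((q z)%:E *
     \int[lebesgue_rV n]_e ((gaussian s2 e)%:E * F (z + e)%R)) =
  \int[lebesgue_rV n]_w ((noisy s2 q w)%:E * F w).
Proof.
move=> mF F0.
have mG : measurable_fun [set: ('rV[R]_n * 'rV[R]_n)%type]
    (fun v => (q v.2 * gaussian s2 (v.1 - v.2))%R%:E * F v.1).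
  by apply: emeasurable_funM => //; exact: (measurableT_comp mF measurable_fst).
transitivity (\int[lebesgue_rV n]_z \int[lebesgue_rV n]_w
    ((q z * gaussian s2 (w - z))%:E * F w)).
  apply: eq_integral => z _; rewrite (integral_gaussian_shift _ _ mF F0).
  rewrite -ge0_integralZl.
  - by apply: eq_integral => w _; rewrite EFinM muleA.
  - exact: measurableT.
  - apply: emeasurable_funM; last exact: mF.
    apply/measurable_EFinP; apply: measurable_gaussian_comp.
    exact: measurable_rV_translation.
  - by move=> w _; rewrite mule_ge0// lee_fin gaussian_ge0.
  - by rewrite lee_fin.
have G0 v : 0 <= (q v.2 * gaussian s2 (v.1 - v.2 : 'rV[R]_n)%R)%R%:E * F v.1.
  by rewrite mule_ge0// lee_fin mulr_ge0// gaussian_ge0.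
rewrite -(fubini_tonelli _ mG G0).
apply: eq_integral => w _ /=; rewrite EFin_noisy ge0_integralZr//.
- exact: (measurable_fun_pair2 w measurable_kernel).
- by move=> z _; rewrite lee_fin mulr_ge0// gaussian_ge0.
Qed.

End noisy.
End gaussian_noise.

(** * Gibbs inequality *)

Section nlog_theory.
Context {R : realType}.

Lemma nlog_pos (x : R) : (0 < x)%R -> nlog x = (- ln x)%:E.
Proof. by move=> x0; rewrite /nlog lne_EFin. Qed.

Lemma nlog_nonpos (x : R) : (x <= 0)%R -> nlog x = +oo.
Proof. by move=> x0; rewrite /nlog le0_lneNy// lee_fin. Qed.

Lemma measurable_nlog d (T : measurableType d) (f : T -> R) :
  measurable_fun [set: T] f -> measurable_fun [set: T] (fun t => nlog (f t)).
Proof.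
move=> mf; rewrite (_ : (fun _ => _) =
    fun t => if (0 < f t)%R then (- ln (f t))%:E else +oo).
  apply: measurable_fun_ifT => //; first exact: measurable_fun_ltr.
  apply/measurable_EFinP; apply: measurableT_comp => //.
  exact: (measurableT_comp (@measurable_ln R) mf).
apply/funext => t; case: ltP => ft; first by rewrite nlog_pos.
by rewrite nlog_nonpos.
Qed.

(* [Q log (y / c) <= Q (y / c - 1)], with the logarithms split so that each
   of them can be integrated separately. *)
Lemma nlog_gibbs (Q x a r m : R) :
  (0 <= Q)%R -> (0 < Q -> 0 < a)%R -> (0 <= x)%R -> (0 <= r)%R -> (0 <= m)%R ->
  (m = 0 -> r = 0)%R ->
  Q%:E + Q%:E * nlog a + Q%:E * nlog m <=
  Q%:E * nlog x + Q%:E * nlog r + (Q * x / a * (r / m))%:E.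
Proof.
rewrite le_eqVlt => /predU1P[<- _ _ _ _ _|Q0 /(_ Q0) a0].
  by rewrite !mul0e !mul0r !adde0.
(* No term is [-oo], so the right-hand side is [+oo] as soon as [x] or [r] vanishes. In the
   remaining case all logarithms are finite. *)
have finite_gtNy y : -oo < Q%:E * nlog y.
  have [y0|y0] := ltP 0%R y; first by rewrite nlog_pos// -EFinM ltNyr.
  by rewrite nlog_nonpos// gt0_muley ?lte_fin.
rewrite le_eqVlt => /predU1P[<- _ _ _|x0].
  rewrite (nlog_nonpos (lexx 0%R)) gt0_muley ?lte_fin//.
  by rewrite addye ?gt_eqF// addye ?leey// gt_eqF// ltNyr.
rewrite le_eqVlt => /predU1P[<- _ _|r0].
  rewrite (nlog_nonpos (lexx 0%R)) gt0_muley ?lte_fin//.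
  by rewrite addey ?gt_eqF// addye ?leey// gt_eqF// ltNyr.
rewrite le_eqVlt => /predU1P[<- /(_ erefl) r00|m0 _].
  by rewrite r00 ltxx in r0.
rewrite !nlog_pos// -!EFinM -!EFinD lee_fin.
have am : (0 < x / a * (r / m))%R by rewrite !mulr_gt0 ?invr_gt0.
have : (ln (x / a * (r / m)) <= x / a * (r / m) - 1)%R.
  have := @le_ln1Dx R (x / a * (r / m) - 1)%R; rewrite addrCA subrr addr0; apply.
  by rewrite ltrBrDr addNr.
rewrite !lnM ?posrE ?mulr_gt0 ?invr_gt0// !lnV ?posrE//.
rewrite -(ler_pM2l Q0).
set y := (x / a * (r / m))%R; rewrite (_ : (Q * x / a * (r / m) = Q * y)%R); last first.
  by rewrite /y !mulrA.
move=> ?; nra.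
Qed.

End nlog_theory.

(** * Integrability and change of variables for expectations *)

Section expectation.
Context {R : realType} d (T : measurableType d) (mu : {measure set T -> \bar R}).

(** With the convention [+oo - +oo = -oo], a finite integral forces the positive and the negative
    part to have finite integrals. *)
Lemma fin_num_integrable (f : T -> \bar R) : measurable_fun [set: T] f ->
  \int[mu]_t f t \is a fin_num -> mu.-integrable [set: T] f.
Proof.
move=> mf fin; apply/integrableP; split => //.
by apply/(abse_integralP _ measurableT mf); rewrite ltey_eq abse_fin_num fin.
Qed.

(** A nonnegative weight commutes with positive and negative parts, so a law known for nonnegative
    functions extends to all measurable ones, both sides being split in the same way. *)
Lemma expect_law d' (Y : measurableType d') (nu : {measure set Y -> \bar R})
    (Q : T -> R) (q : Y -> R) (y : T -> Y) :
  (forall t, (0 <= Q t)%R) -> (forall x, (0 <= q x)%R) ->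
  (forall F : Y -> \bar R, measurable_fun [set: Y] F -> (forall x, 0 <= F x) ->
     expect mu Q (F \o y) = expect nu q F) ->
  forall F : Y -> \bar R, measurable_fun [set: Y] F ->
  expect mu Q (F \o y) = expect nu q F.
Proof.
move=> Q0 q0 law F mF.
have pE t : (fun t => (Q t)%:E * F (y t))^\+ t = (Q t)%:E * (F^\+ \o y) t.
  by rewrite /= !funeposE maxe_pMr ?lee_fin// mule0.
have nE t : (fun t => (Q t)%:E * F (y t))^\- t = (Q t)%:E * (F^\- \o y) t.
  by rewrite /= !funenegE maxe_pMr ?lee_fin// mule0 muleN.
have pE' x : (fun x => (q x)%:E * F x)^\+ x = (q x)%:E * F^\+ x.
  by rewrite !funeposE maxe_pMr ?lee_fin// mule0.
have nE' x : (fun x => (q x)%:E * F x)^\- x = (q x)%:E * F^\- x.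
  by rewrite !funenegE maxe_pMr ?lee_fin// mule0 muleN.
rewrite /expect integralE [RHS]integralE; congr (_ - _).
  under eq_integral do rewrite pE; under [RHS]eq_integral do rewrite pE'.
  by apply: law; [exact: measurable_funepos|move=> x; exact: funepos_ge0].
under eq_integral do rewrite nE; under [RHS]eq_integral do rewrite nE'.
by apply: law; [exact: measurable_funeneg|move=> x; exact: funeneg_ge0].
Qed.

End expectation.

(** On nonnegative reals the inverse, with value 0 at 0, is the power of exponent -1. *)
Lemma measurable_fun_inv_ge0 {R : realType} d (T : measurableType d) (f : T -> R) :
  (forall t, (0 <= f t)%R) -> measurable_fun [set: T] f ->
  measurable_fun [set: T] (fun t => (f t)^-1%R).
Proof.
move=> f0 mf; rewrite (_ : (fun _ => _) = (fun t => (f t `^ (-1))%R)).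
  exact: (measurableT_comp (@measurable_powR R (-1)%R) mf).
by apply/funext => t; rewrite powR_inv1.
Qed.

(** * The entropy bound for a single domain *)

Section entropy_bound.
Context {R : realType} d1 d2 d3 (T : measurableType d1) (X : measurableType d2)
  (W : measurableType d3).
Variables (mu : {measure set T -> \bar R}) (nu : {measure set X -> \bar R})
  (lam : {measure set W -> \bar R}).
(** [T] carries input and noise, and for a decoder also the latent. The factor [u] is the absolute
    Jacobian for a flow and the ratio of decoder to encoder for a VAE, so both losses take the same
    form. *)
Variables (Q u : T -> R) (qx : X -> R) (r p m : W -> R) (xi : T -> X) (w : T -> W).
Hypotheses (mQ : measurable_fun [set: T] Q) (m_u : measurable_fun [set: T] u)
  (mqx : measurable_fun [set: X] qx) (mr : measurable_fun [set: W] r)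
  (mp : measurable_fun [set: W] p) (mm : measurable_fun [set: W] m)
  (mxi : measurable_fun [set: T] xi) (mw : measurable_fun [set: T] w).
Hypotheses (Q0 : forall t, (0 <= Q t)%R) (u0 : forall t, (0 <= u t)%R)
  (qx0 : forall x, (0 <= qx x)%R) (r0 : forall z, (0 <= r z)%R)
  (p0 : forall z, (0 <= p z)%R) (m0 : forall z, (0 <= m z)%R).
Hypothesis Qqx : forall t, (0 < Q t -> 0 < qx (xi t))%R.
Hypothesis rm : forall z, (m z = 0 -> r z = 0)%R.
Hypothesis lawX : forall F : X -> \bar R, measurable_fun [set: X] F ->
  (forall x, 0 <= F x) -> expect mu Q (F \o xi) = expect nu qx F.
Hypothesis lawW : forall F : W -> \bar R, measurable_fun [set: W] F ->
  (forall z, 0 <= F z) -> expect mu Q (F \o w) = expect lam r F.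
Hypothesis contraction : forall F : W -> \bar R, measurable_fun [set: W] F ->
  (forall z, 0 <= F z) ->
  expect mu (fun t => Q t * u t / qx (xi t))%R (F \o w) <= \int[lam]_z F z.
Hypothesis qx1 : \int[nu]_x (qx x)%:E = 1.
Hypothesis fin_loss :
  expect mu Q (fun t => nlog (u t * p (w t))%R) \is a fin_num.
Hypothesis fin_qx : entropy nu qx \is a fin_num.
Hypothesis fin_r : entropy lam r \is a fin_num.
Hypothesis fin_m : expect lam r (fun z => nlog (m z)) \is a fin_num.
Hypothesis fin_pr : \int[lam]_z (p z * (r z / m z))%:E \is a fin_num.

(** Integrate [nlog_gibbs] with [a = qx (xi t)] and [x = u t * p (w t)]. Each term is integrable
    because its integral is finite, so the sums split; the laws of [xi] and [w] identify the pieces,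
    and [contraction] bounds the last one. *)
Lemma cross_entropy_bound :
  1 + entropy nu qx + expect lam r (fun z => nlog (m z)) <=
  expect mu Q (fun t => nlog (u t * p (w t))%R) + entropy lam r +
  \int[lam]_z (p z * (r z / m z))%:E.
Proof.
have mqxi : measurable_fun [set: T] (qx \o xi) by exact: measurableT_comp.
have m_w (f : W -> R) : measurable_fun [set: W] f -> measurable_fun [set: T] (f \o w).
  by move=> mf; exact: measurableT_comp.
have Wlaw F : measurable_fun [set: W] F -> expect mu Q (F \o w) = expect lam r F.
  by move=> mF; exact: expect_law.
have Xlaw F : measurable_fun [set: X] F -> expect mu Q (F \o xi) = expect nu qx F.
  by move=> mF; exact: expect_law.
have mEQ : measurable_fun [set: T] (EFin \o Q) by exact/measurable_EFinP.
pose A1 t := (Q t)%:E * nlog (u t * p (w t))%R.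
pose A2 t := (Q t)%:E * nlog (qx (xi t)).
pose A3 t := (Q t)%:E * nlog (r (w t)).
pose A4 t := (Q t)%:E * nlog (m (w t)).
pose Y t := (Q t * (u t * p (w t)) / qx (xi t) * (r (w t) / m (w t)))%R.
have mpr : measurable_fun [set: W] (fun z => (p z * (r z / m z))%R).
  apply: measurable_funM => //; apply: measurable_funM => //.
  exact: measurable_fun_inv_ge0.
(* Separating the weight from the function of [w t] puts the last term in the form required by
   [contraction]. *)
have YE t : (Y t)%:E = (Q t * u t / qx (xi t))%R%:E *
    (p (w t) * (r (w t) / m (w t)))%R%:E.
  by rewrite -EFinM /Y; congr EFin; ring.
have Y0 t : (0 <= Y t)%R by rewrite /Y !mulr_ge0 ?invr_ge0.
have mY : measurable_fun [set: T] Y.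
  rewrite /Y; apply: measurable_funM; last first.
    apply: measurable_funM; first exact: m_w.
    by apply: measurable_fun_inv_ge0 => //; exact: m_w.
  apply: measurable_funM; last exact: measurable_fun_inv_ge0.
  by apply: measurable_funM => //; apply: measurable_funM => //; exact: m_w.
have intY_le : \int[mu]_t (Y t)%:E <= \int[lam]_z (p z * (r z / m z))%:E.
  under eq_integral do rewrite YE.
  apply: (contraction (F := fun z => (p z * (r z / m z))%:E)).
    exact/measurable_EFinP.
  by move=> z; rewrite lee_fin !mulr_ge0 ?invr_ge0.
(* The law of [xi] applied to the constant 1 gives the total mass of [Q]. *)
have intQ : \int[mu]_t (Q t)%:E = 1.
  have := lawX (F := cst 1) (measurable_cst _) (fun=> lee01).
  rewrite /expect; under eq_integral do rewrite mule1.
  by under [in RHS]eq_integral do rewrite mule1; rewrite qx1.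
have iQ : mu.-integrable [set: T] (EFin \o Q).
  by apply: fin_num_integrable => //; rewrite intQ.
have mA (f : T -> R) : measurable_fun [set: T] f ->
    measurable_fun [set: T] (fun t => (Q t)%:E * nlog (f t)).
  by move=> mf; apply: emeasurable_funM => //; exact: measurable_nlog.
have mup : measurable_fun [set: T] (fun t => (u t * p (w t))%R).
  by apply: measurable_funM => //; exact: m_w.
have iA1 : mu.-integrable [set: T] A1 by apply: fin_num_integrable => //; exact: mA.
have E2 : \int[mu]_t A2 t = entropy nu qx by exact: (Xlaw _ (measurable_nlog mqx)).
have E3 : \int[mu]_t A3 t = entropy lam r by exact: (Wlaw _ (measurable_nlog mr)).
have E4 : \int[mu]_t A4 t = expect lam r (fun z => nlog (m z)).
  exact: (Wlaw _ (measurable_nlog mm)).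
have iA2 : mu.-integrable [set: T] A2.
  by apply: fin_num_integrable; [exact: mA|rewrite E2].
have iA3 : mu.-integrable [set: T] A3.
  by apply: fin_num_integrable; [apply: mA; exact: m_w|rewrite E3].
have iA4 : mu.-integrable [set: T] A4.
  by apply: fin_num_integrable; [apply: mA; exact: m_w|rewrite E4].
have iY : mu.-integrable [set: T] (EFin \o Y).
  apply: fin_num_integrable; first exact/measurable_EFinP.
  rewrite ge0_fin_numE; last by apply: integral_ge0 => t _; rewrite lee_fin.
  by rewrite (le_lt_trans intY_le)// ltey_eq fin_pr.
have iQA2 := integrableD measurableT iQ iA2.
have iA13 := integrableD measurableT iA1 iA3.
have le : \int[mu]_t ((Q t)%:E + A2 t + A4 t) <= \int[mu]_t (A1 t + A3 t + (Y t)%:E).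
  apply: le_integral => //; [exact: integrableD|exact: integrableD|move=> t _].
  by apply: nlog_gibbs => //; [exact: Qqx|rewrite mulr_ge0|exact: rm].
move: le; rewrite (integralD measurableT iQA2 iA4) (integralD measurableT iQ iA2).
rewrite (integralD measurableT iA13 iY) (integralD measurableT iA1 iA3).
by rewrite intQ E2 E3 E4 => /le_trans; apply; rewrite leeD2l.
Qed.

End entropy_bound.

(** Finiteness of a weighted mean passes to the summands of positive weight only, since a zero
    weight hides an infinite value. *)
Lemma fin_num_mulr_pos {R : realType} (a : R) (x : \bar R) : (0 < a)%R ->
  a%:E * x \is a fin_num -> x \is a fin_num.
Proof.
move=> a0; case: x => // [|]; first by rewrite gt0_muley ?lte_fin.
by rewrite gt0_muleNy ?lte_fin.
Qed.

Lemma domain_mean_fin_num {R : realType} k (qd : 'I_k -> R) (F : 'I_k -> \bar R) d :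
  domain_mean qd F \is a fin_num -> (qd d)%:E * F d \is a fin_num.
Proof. by move=> /sum_fin_numP; apply => //; rewrite mem_index_enum. Qed.

(** * Averaging over the domains *)

Section gjsd_bound.
Context {R : realType} d1 d2 d3 (T : measurableType d1) (X : measurableType d2)
  (W : measurableType d3).
Variables (mu : {measure set T -> \bar R}) (nu : {measure set X -> \bar R})
  (lam : {measure set W -> \bar R}).
Variables (k : nat) (qd : 'I_k -> R) (Q u : 'I_k -> T -> R) (qx : 'I_k -> X -> R)
  (r : 'I_k -> W -> R) (p : W -> R) (xi : T -> X) (w : 'I_k -> T -> W).
Hypotheses (mQ : forall d, measurable_fun [set: T] (Q d))
  (m_u : forall d, measurable_fun [set: T] (u d))
  (hqx : forall d, is_density nu (qx d))
  (mr : forall d, measurable_fun [set: W] (r d))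
  (hp : is_density lam p)
  (mxi : measurable_fun [set: T] xi)
  (mw : forall d, measurable_fun [set: T] (w d)).
Hypotheses (hqd : is_pmf qd)
  (Q0 : forall d t, (0 <= Q d t)%R) (u0 : forall d t, (0 <= u d t)%R)
  (r0 : forall d z, (0 <= r d z)%R).
Hypothesis Qqx : forall d t, (0 < Q d t -> 0 < qx d (xi t))%R.
Hypothesis lawX : forall d (F : X -> \bar R), measurable_fun [set: X] F ->
  (forall x, 0 <= F x) -> expect mu (Q d) (F \o xi) = expect nu (qx d) F.
Hypothesis lawW : forall d (F : W -> \bar R), measurable_fun [set: W] F ->
  (forall z, 0 <= F z) -> expect mu (Q d) (F \o w d) = expect lam (r d) F.
Hypothesis contraction : forall d (F : W -> \bar R), measurable_fun [set: W] F ->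
  (forall z, 0 <= F z) ->
  expect mu (fun t => Q d t * u d t / qx d (xi t))%R (F \o w d) <=
  \int[lam]_z F z.

Let loss := domain_mean qd (fun d =>
  expect mu (Q d) (fun t => nlog (u d t * p (w d t))%R)).

Hypotheses (fin_loss : loss \is a fin_num)
  (fin_qx : cond_entropy nu qd qx \is a fin_num)
  (fin_r : cond_entropy lam qd r \is a fin_num)
  (fin_m : entropy lam (mixture qd r) \is a fin_num).

Let m := mixture qd r.

Let qd0 d : (0 <= qd d)%R. Proof. exact: hqd.1. Qed.

Let m0 z : (0 <= m z)%R.
Proof. by apply: sumr_ge0 => d _; rewrite mulr_ge0. Qed.

Let mm : measurable_fun [set: W] m.
Proof. by apply: measurable_sum => d; exact: measurable_funM. Qed.

Let le_m d z : (qd d * r d z <= m z)%R.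
Proof.
rewrite /m /mixture (bigD1 d)//= lerDl; apply: sumr_ge0 => i _.
by rewrite mulr_ge0.
Qed.

Let rm d z : (0 < qd d)%R -> (m z = 0 -> r d z = 0)%R.
Proof.
move=> d0 mz0; apply/eqP; rewrite eq_le r0 andbT.
by have := le_m d z; rewrite mz0 pmulr_rle0.
Qed.

(** Since [qd d * r d z <= m z], the integrand is dominated by that of the entropy of the
    mixture. *)
Let integrable_nlog_m d : lam.-integrable [set: W]
  (fun z => (qd d * r d z)%:E * nlog (m z)).
Proof.
have im : lam.-integrable [set: W] (fun z => (m z)%:E * nlog (m z)).
  apply: fin_num_integrable fin_m; apply: emeasurable_funM.
    exact/measurable_EFinP.
  exact: measurable_nlog.
apply: le_integrable im => //.
  apply: emeasurable_funM; last exact: measurable_nlog.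
  by apply/measurable_EFinP; exact: measurable_funM.
move=> z _; rewrite !abseM; apply: lee_wpmul2r => //.
by rewrite lee_fin !ger0_norm// mulr_ge0.
Qed.

Let integrable_r_nlog_m d : (0 < qd d)%R -> lam.-integrable [set: W]
  (fun z => (r d z)%:E * nlog (m z)).
Proof.
move=> d0; apply: eq_integrable (integrableZl measurableT (qd d)^-1 (integrable_nlog_m d)) => //.
by move=> z _; rewrite muleA -EFinM mulKf ?gt_eqF.
Qed.

Let entropy_mixture :
  \sum_(d < k) (qd d)%:E * expect lam (r d) (fun z => nlog (m z)) = entropy lam m.
Proof.
transitivity (\sum_(d < k) \int[lam]_z ((qd d * r d z)%:E * nlog (m z))).
  (* A domain of probability zero contributes 0 on both sides, even if its cross entropy is
     infinite. *)
  apply: eq_bigr => d _; have := qd0 d; rewrite le_eqVlt => /predU1P[<-|d0].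
    by rewrite mul0e integral0_eq// => z _; rewrite mul0r mul0e.
  rewrite -integralZl//; last exact: integrable_r_nlog_m.
  by apply: eq_integral => z _; rewrite EFinM muleA.
rewrite -integral_sum//; apply: eq_integral => z _.
rewrite -ge0_sume_distrl; last by move=> d _; rewrite lee_fin mulr_ge0.
by rewrite sumEFin.
Qed.

(** The weighted sum of the ratios [r d z / m z] is 1 where [m] is nonzero and 0 where it vanishes,
    so what remains is at most the mass of [p]. *)
Let ratio_sum_le1 :
  \sum_(d < k) (qd d)%:E * \int[lam]_z (p z * (r d z / m z))%:E <= 1.
Proof.
have [mp p0 p1] := hp.
have mratio d : measurable_fun [set: W] (fun z => (p z * (r d z / m z))%:E).
  apply/measurable_EFinP; apply: measurable_funM => //; apply: measurable_funM => //.
  exact: measurable_fun_inv_ge0.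
have ratio0 d z : (0 <= p z * (r d z / m z))%R by rewrite !mulr_ge0 ?invr_ge0.
rewrite (eq_bigr (fun d => \int[lam]_z ((qd d)%:E * (p z * (r d z / m z))%:E))); last first.
  move=> d _; rewrite ge0_integralZl ?lee_fin//.
  by move=> z _; rewrite lee_fin.
rewrite -ge0_integral_sum//; last 2 first.
- by move=> d; exact: measurable_funeM.
- by move=> d z _; rewrite mule_ge0// lee_fin.
rewrite -p1; apply: ge0_le_integral => //.
- by move=> z _; apply: sume_ge0 => d _; rewrite mule_ge0// lee_fin.
- by apply: emeasurable_sum => d; exact: measurable_funeM.
- exact/measurable_EFinP.
move=> z _; under eq_bigr do rewrite -EFinM.
rewrite sumEFin lee_fin.
rewrite (eq_bigr (fun d => p z / m z * (qd d * r d z))%R); last by move=> d _; ring.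
rewrite -mulr_sumr -[X in (_ * X)%R]/(m z).
have [->|mz] := eqVneq (m z) 0%R; first by rewrite mulr0.
by rewrite divfK.
Qed.

(** Averaging the single-domain bounds leaves the total probability 1 on the left, which compensates
    the sum of ratios on the right. *)
Lemma gjsd_le_loss : gjsd lam qd r <= loss - cond_entropy nu qd qx.
Proof.
have [mp p0 p1] := hp.
pose Y d := \int[lam]_z (p z * (r d z / m z))%:E.
have Y0 d : 0 <= Y d by apply: integral_ge0 => z _; rewrite lee_fin !mulr_ge0 ?invr_ge0.
have finS : \sum_(d < k) (qd d)%:E * Y d \is a fin_num.
  rewrite ge0_fin_numE; first by rewrite (le_lt_trans ratio_sum_le1)// ltry.
  by apply: sume_ge0 => d _; rewrite mule_ge0// lee_fin.
have bound d : (qd d)%:E + (qd d)%:E * entropy nu (qx d) +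
    (qd d)%:E * expect lam (r d) (fun z => nlog (m z)) <=
    (qd d)%:E * expect mu (Q d) (fun t => nlog (u d t * p (w d t))%R) +
    (qd d)%:E * entropy lam (r d) + (qd d)%:E * Y d.
  (* The finiteness facts are available only for domains of positive probability; for the others
     both sides are 0. *)
  have := qd0 d; rewrite le_eqVlt => /predU1P[<-|d0]; first by rewrite !mul0e !adde0.
  have [mqx qx0 qx1] := hqx d.
  have f1 := fin_num_mulr_pos d0 (domain_mean_fin_num d fin_loss).
  have f2 := fin_num_mulr_pos d0 (domain_mean_fin_num d fin_qx).
  have f3 := fin_num_mulr_pos d0 (domain_mean_fin_num d fin_r).
  have f4 : expect lam (r d) (fun z => nlog (m z)) \is a fin_num.
    by apply: integrable_fin_num => //; exact: integrable_r_nlog_m.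
  have f5 : Y d \is a fin_num := fin_num_mulr_pos d0 (domain_mean_fin_num d finS).
  have b := cross_entropy_bound (mQ d) (m_u d) mqx (mr d) mp mm mxi (mw d)
    (Q0 d) (u0 d) qx0 (r0 d) p0 m0 (@Qqx d) (fun z => @rm d z d0)
    (@lawX d) (@lawW d) (@contraction d) qx1 f1 f2 f3 f4 f5.
  move: b; rewrite -/(Y d) -(fineK f1) -(fineK f2) -(fineK f3) -(fineK f4) -(fineK f5).
  rewrite -!EFinM -!EFinD !lee_fin -(ler_pM2l d0) => b; lra.
have : \sum_(d < k) ((qd d)%:E + (qd d)%:E * entropy nu (qx d) +
    (qd d)%:E * expect lam (r d) (fun z => nlog (m z))) <=
  \sum_(d < k) ((qd d)%:E * expect mu (Q d) (fun t => nlog (u d t * p (w d t))%R) +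
    (qd d)%:E * entropy lam (r d) + (qd d)%:E * Y d).
  by apply: lee_sum => d _; exact: bound.
rewrite !big_split/= entropy_mixture sumEFin hqd.2 -/loss.
rewrite -[X in 1 + X]/(cond_entropy nu qd qx) -[X in loss + X]/(cond_entropy lam qd r).
have := ratio_sum_le1; rewrite /gjsd -/m.
have fin_m' : entropy lam m \is a fin_num by exact: fin_m.
rewrite -(fineK fin_loss) -(fineK fin_qx) -(fineK fin_r) -(fineK fin_m') -(fineK finS).
rewrite -!EFinD !lee_fin => ? ?; lra.
Qed.

End gjsd_bound.

(** * Noisy latents of flows and of decoders *)

Section noise_channel.
Context {R : realType} d (S : measurableType d)
  (sigma : {sigma_finite_measure set S -> \bar R}) (n : nat) (s2 : R).
Variables (a : S -> R) (z : S -> 'rV[R]_n).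
Hypotheses (s0 : (0 < s2)%R) (ma : measurable_fun [set: S] a)
  (a0 : forall s, (0 <= a s)%R) (mz : measurable_fun [set: S] z).

Let mu := (sigma \x lebesgue_rV n).

Let measurable_weight : measurable_fun [set: (S * 'rV[R]_n)%type]
  (fun t => (a t.1 * gaussian s2 t.2)%R%:E).
Proof.
apply/measurable_EFinP; apply: measurable_funM.
  exact: (measurableT_comp ma measurable_fst).
exact: measurable_gaussian_comp.
Qed.

Lemma measurable_noisy_sum :
  measurable_fun [set: (S * 'rV[R]_n)%type] (fun t => (z t.1 + t.2)%R).
Proof.
apply: measurable_fun_rV => i; under eq_fun do rewrite mxE.
apply: measurable_funD.
  exact: (measurableT_comp (measurable_coord_rV i) (measurableT_comp mz measurable_fst)).
exact: (measurableT_comp (measurable_coord_rV i) measurable_snd).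
Qed.

Lemma expect_noise (F : 'rV[R]_n -> \bar R) :
  measurable_fun [set: 'rV[R]_n] F -> (forall v, 0 <= F v) ->
  expect mu (fun t => a t.1 * gaussian s2 t.2)%R (fun t => F (z t.1 + t.2)%R) =
  \int[sigma]_s ((a s)%:E *
    \int[lebesgue_rV n]_e ((gaussian s2 e)%:E * F (z s + e)%R)).
Proof.
move=> mF F0.
have mH : measurable_fun [set: (S * 'rV[R]_n)%type]
    (fun t => (a t.1 * gaussian s2 t.2)%R%:E * F (z t.1 + t.2)%R).
  apply: emeasurable_funM; first exact: measurable_weight.
  exact: (measurableT_comp mF measurable_noisy_sum).
have H0 (t : S * 'rV[R]_n) : 0 <= (a t.1 * gaussian s2 t.2)%R%:E * F (z t.1 + t.2)%R.
  by rewrite mule_ge0// lee_fin mulr_ge0// gaussian_ge0.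
rewrite /expect (fubini_tonelli1 _ mH H0); apply: eq_integral => s _.
rewrite /fubini_F /= -ge0_integralZl.
- by apply: eq_integral => e _; rewrite EFinM muleA.
- exact: measurableT.
- apply: emeasurable_funM; first by apply/measurable_EFinP; exact: measurable_gaussian.
  exact: (measurable_fun_pair2 s (measurableT_comp mF measurable_noisy_sum)).
- by move=> e _; rewrite mule_ge0// lee_fin gaussian_ge0.
- by rewrite lee_fin.
Qed.

Lemma expect_noise_fst (F : S -> \bar R) :
  measurable_fun [set: S] F -> (forall s, 0 <= F s) ->
  expect mu (fun t => a t.1 * gaussian s2 t.2)%R (fun t => F t.1) =
  expect sigma a F.
Proof.
move=> mF F0.
have mH : measurable_fun [set: (S * 'rV[R]_n)%type]
    (fun t => (a t.1 * gaussian s2 t.2)%R%:E * F t.1).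
  apply: emeasurable_funM; first exact: measurable_weight.
  exact: (measurableT_comp mF measurable_fst).
have H0 (t : S * 'rV[R]_n) : 0 <= (a t.1 * gaussian s2 t.2)%R%:E * F t.1.
  by rewrite mule_ge0// lee_fin mulr_ge0// gaussian_ge0.
rewrite /expect (fubini_tonelli1 _ mH H0); apply: eq_integral => s _.
rewrite /fubini_F /=.
under eq_integral do rewrite (mulrC (a s)) EFinM -muleA.
rewrite ge0_integralZr.
- by rewrite integral_gaussian mul1e.
- exact: measurableT.
- by apply/measurable_EFinP; exact: measurable_gaussian.
- by move=> e _; rewrite lee_fin gaussian_ge0.
- by rewrite mule_ge0// lee_fin.
Qed.

(** After the shift and Tonelli, [F w] is multiplied by the integral over [s] of
    [a s * gaussian s2 (w - z s)]. A bound by 1 for each [w] therefore suffices. *)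
Lemma expect_noise_le (F : 'rV[R]_n -> \bar R) :
  measurable_fun [set: 'rV[R]_n] F -> (forall v, 0 <= F v) ->
  (forall w, \int[sigma]_s (a s * gaussian s2 (w - z s))%:E <= 1) ->
  expect mu (fun t => a t.1 * gaussian s2 t.2)%R (fun t => F (z t.1 + t.2)%R) <=
  \int[lebesgue_rV n]_w F w.
Proof.
move=> mF F0 h; rewrite expect_noise//.
have mK : measurable_fun [set: (S * 'rV[R]_n)%type]
    (fun t => (a t.1 * gaussian s2 (t.2 - z t.1))%R%:E).
  apply/measurable_EFinP; apply: measurable_funM.
    exact: (measurableT_comp ma measurable_fst).
  apply: measurable_gaussian_comp.
  apply: measurable_fun_rV => i; under eq_fun do rewrite !mxE.
  apply: measurable_funB.
    exact: (measurableT_comp (measurable_coord_rV i) measurable_snd).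
  exact: (measurableT_comp (measurable_coord_rV i) (measurableT_comp mz measurable_fst)).
have K0 (t : S * 'rV[R]_n) : 0 <= (a t.1 * gaussian s2 (t.2 - z t.1))%R%:E.
  by rewrite lee_fin mulr_ge0// gaussian_ge0.
have mH : measurable_fun [set: (S * 'rV[R]_n)%type]
    (fun t => (a t.1 * gaussian s2 (t.2 - z t.1))%R%:E * F t.2).
  by apply: emeasurable_funM => //; exact: (measurableT_comp mF measurable_snd).
have H0 (t : S * 'rV[R]_n) : 0 <= (a t.1 * gaussian s2 (t.2 - z t.1))%R%:E * F t.2.
  by rewrite mule_ge0.
have -> : \int[sigma]_s ((a s)%:E *
    \int[lebesgue_rV n]_e ((gaussian s2 e)%:E * F (z s + e)%R)) =
  \int[sigma]_s \int[lebesgue_rV n]_w ((a s * gaussian s2 (w - z s))%:E * F w).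
  apply: eq_integral => s _; rewrite (integral_gaussian_shift _ _ mF F0).
  rewrite -ge0_integralZl.
  - by apply: eq_integral => w _; rewrite EFinM muleA.
  - exact: measurableT.
  - apply: emeasurable_funM; last exact: mF.
    apply/measurable_EFinP; apply: measurable_gaussian_comp.
    exact: measurable_rV_translation.
  - by move=> w _; rewrite mule_ge0// lee_fin gaussian_ge0.
  - by rewrite lee_fin.
rewrite (fubini_tonelli _ mH H0); apply: ge0_le_integral.
- exact: measurableT.
- by move=> w _; apply: integral_ge0 => s _; exact: (H0 (s, w)).
- exact: (measurable_fun_fubini_tonelli_G (m1 := sigma) _ mH H0).
- by [].
move=> w _ /=; rewrite ge0_integralZr.
- by rewrite -[leRHS]mul1e lee_wpmul2r.
- exact: measurableT.
- exact: (measurable_fun_pair1 w mK).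
- by move=> s _; exact: (K0 (s, w)).
- exact: F0.
Qed.

Lemma measurable_integral_noise (F : 'rV[R]_n -> \bar R) :
  measurable_fun [set: 'rV[R]_n] F -> (forall v, 0 <= F v) ->
  measurable_fun [set: S] (fun s =>
    \int[lebesgue_rV n]_e ((gaussian s2 e)%:E * F (z s + e)%R)).
Proof.
move=> mF F0.
have mH : measurable_fun [set: (S * 'rV[R]_n)%type]
    (fun t => (gaussian s2 t.2)%:E * F (z t.1 + t.2)%R).
  apply: emeasurable_funM.
    by apply/measurable_EFinP; exact: measurable_gaussian_comp.
  exact: (measurableT_comp mF measurable_noisy_sum).
apply: (measurable_fun_fubini_tonelli_F (m2 := lebesgue_rV n) _ mH) => t.
by rewrite mule_ge0// lee_fin gaussian_ge0.
Qed.

End noise_channel.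

(** * From image densities on sets to expectations *)

Section density_of_image.
Context {R : realType} d1 d2 (T : measurableType d1) (Y : measurableType d2)
  (mu : {measure set T -> \bar R}) (nu : {measure set Y -> \bar R}).
Import HBNNSimple.

(** The defining identity on sets extends to simple functions through their level sets, and then to
    [F] by monotone convergence. *)
Lemma expect_density_of_image (q : T -> R) (f : T -> Y) (r : Y -> R)
    (F : Y -> \bar R) :
  measurable_fun [set: T] q -> (forall t, (0 <= q t)%R) ->
  measurable_fun [set: T] f -> is_density_of_image mu nu q f r ->
  measurable_fun [set: Y] F -> (forall y, 0 <= F y) ->
  expect mu q (F \o f) = expect nu r F.
Proof.
move=> mq q0 mf [[mr r0 _] h] mF F0.
pose phi := nnsfun_approx measurableT mF.
have simple (s : {nnsfun Y >-> R}) :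
    \int[mu]_t ((q t)%:E * (s (f t))%:E) = \int[nu]_y ((r y)%:E * (s y)%:E).
  (* The map [e] is left general so that one expansion serves both sides, with [e = f] and with
     [e = id]; [lim] below follows the same pattern. *)
  have expand d (U : measurableType d) (rho : {measure set U -> \bar R})
      (v : U -> R) (e : U -> Y) : measurable_fun [set: U] v ->
      (forall x, (0 <= v x)%R) -> measurable_fun [set: U] e ->
    \int[rho]_x ((v x)%:E * (s (e x))%:E) =
    \sum_(k \in range s) (k%:E * \int[rho]_(x in e @^-1` (s @^-1` [set k])) (v x)%:E).
    move=> mv v0 me.
    have mek k : measurable (e @^-1` (s @^-1` [set k])).
      by rewrite -[X in measurable X]setTI; exact: me.
    transitivity (\int[rho]_x (\sum_(k \in range s)
        (k * (v x * \1_(e @^-1` (s @^-1` [set k])) x))%:E)).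
      apply: eq_integral => x _; rewrite -EFinM fimfunE fsumEFin//; congr EFin.
      rewrite mulr_fsumr//; apply: eq_fsbigr => k _.
      by rewrite mulrCA.
    rewrite ge0_integral_fsum//; last 2 first.
    - move=> k; apply/measurable_EFinP; apply: measurable_funM => //.
      by apply: measurable_funM => //; exact: measurable_indic.
    - move=> k x _; rewrite lee_fin mulrCA mulr_ge0//.
      have [xk|xk] := pselect (s (e x) = k); first by rewrite mulr_ge0// -xk.
      by rewrite indicE memNset ?mulr0.
    apply: eq_fsbigr => k /[!inE] -[y _ <-].
    under eq_integral do rewrite EFinM.
    rewrite ge0_integralZl//; last 3 first.
    - by apply/measurable_EFinP; apply: measurable_funM => //; exact: measurable_indic.
    - by move=> x _; rewrite lee_fin mulr_ge0.
    - by rewrite lee_fin.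
    congr (_ * _); rewrite [RHS]integral_mkcond; apply: eq_integral => x _.
    by rewrite patchE indicE; case: ifPn => _; rewrite ?mulr1 ?mulr0.
  rewrite (expand _ _ _ _ _ mq q0 mf) (expand _ _ _ _ id mr r0 (@measurable_id _ _ _)).
  apply: eq_fsbigr => k _; rewrite h//.
  by rewrite -[X in measurable X]setTI; exact: (measurable_funP s).
have lim d (U : measurableType d) (rho : {measure set U -> \bar R})
    (v : U -> R) (e : U -> Y) : measurable_fun [set: U] v ->
    (forall x, (0 <= v x)%R) -> measurable_fun [set: U] e ->
  \int[rho]_x ((v x)%:E * F (e x)) =
  limn (fun i => \int[rho]_x ((v x)%:E * (phi i (e x))%:E)).
  move=> mv v0 me.
  have mphie i : measurable_fun [set: U] (fun x => (v x)%:E * (phi i (e x))%:E).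
    apply: emeasurable_funM; first exact/measurable_EFinP.
    by apply/measurable_EFinP; exact: (measurableT_comp (measurable_funP (phi i)) me).
  rewrite -monotone_convergence//.
  - apply: eq_integral => x _; apply/esym/cvg_lim => //.
    apply: cvgeZl => //; exact: cvg_nnsfun_approx.
  - by move=> i x _; rewrite mule_ge0// lee_fin.
  - move=> x _ i j ij; rewrite lee_wpmul2l ?lee_fin//.
    exact/lefP/nd_nnsfun_approx.
rewrite /expect (lim _ _ _ _ _ mq q0 mf) (lim _ _ _ _ id mr r0 (@measurable_id _ _ _)).
by under eq_fun do rewrite simple.
Qed.

End density_of_image.

Lemma minimum_attained {R : realType} T (A : set T) (L : T -> \bar R) :
  min_attained A L -> exists2 a, A a & minimum A L = L a /\ L a \is a fin_num.
Proof.
move=> [a Aa [fa la]]; exists a => //; split => //; apply/eqP.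
rewrite eq_le ereal_inf_lbound/=; last by exists a.
by apply: le_ereal_inf_tmp => _ [b Ab <-]; exact: la.
Qed.

(** * The bound for flows *)

Section flow_bound.
Context {R : realType} (k n : nat) (qd : 'I_k -> R) (qx : 'I_k -> 'rV[R]_n -> R)
  (s2 : R) (g : 'I_k -> 'rV[R]_n -> 'rV[R]_n) (qz : 'I_k -> 'rV[R]_n -> R)
  (p : 'rV[R]_n -> R).
Hypotheses (hqd : is_pmf qd) (hqx : forall d, is_density (lebesgue_rV n) (qx d))
  (s0 : (0 < s2)%R) (hg : is_flow g)
  (hqz : forall d, is_density_of_image (lebesgue_rV n) (lebesgue_rV n)
                     (qx d) (g d) (qz d))
  (hp : is_density (lebesgue_rV n) p)
  (fin_qx : cond_entropy (lebesgue_rV n) qd qx \is a fin_num)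
  (fin_m : entropy (lebesgue_rV n) (mixture qd (fun d => noisy s2 (qz d)))
        \is a fin_num)
  (fin_r : cond_entropy (lebesgue_rV n) qd (fun d => noisy s2 (qz d))
        \is a fin_num)
  (fin_loss : naub_loss qd qx g s2 p \is a fin_num).

Lemma njsd_le_naub_loss :
  njsd qd qz s2 <= naub_loss qd qx g s2 p - cond_entropy (lebesgue_rV n) qd qx.
Proof.
have mqx d : measurable_fun [set: 'rV[R]_n] (qx d) by have [] := hqx d.
have qx0 d x : (0 <= qx d x)%R by have [] := hqx d.
have [mqz qz0 qz1] : [/\ forall d, measurable_fun [set: 'rV[R]_n] (qz d),
    forall d z, (0 <= qz d z)%R & forall d, \int[lebesgue_rV n]_z (qz d z)%:E = 1].
  by split=> d; have [[]] := hqz d.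
have dg d x : differentiable (g d) x by have [? []] := hg d.
have mg d : measurable_fun [set: 'rV[R]_n] (g d).
  apply: measurable_fun_continuous_rV_rV => x.
  exact: differentiable_continuous.
have mJ d : measurable_fun [set: 'rV[R]_n] (abs_jacobian g d).
  exact: measurable_fun_abs_jacobian.
have J0 d x : (0 <= abs_jacobian g d x)%R by exact: normr_ge0.
have mfst (f : 'rV[R]_n -> R) : measurable_fun [set: 'rV[R]_n] f ->
    measurable_fun [set: ('rV[R]_n * 'rV[R]_n)%type] (fun t => f t.1).
  by move=> mf; exact: (measurableT_comp mf measurable_fst).
have mQ d : measurable_fun [set: ('rV[R]_n * 'rV[R]_n)%type]
    (fun t => qx d t.1 * gaussian s2 t.2)%R.
  by apply: measurable_funM; [exact: mfst|exact: measurable_gaussian_comp].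
apply: (@gjsd_le_loss _ _ _ _ _ _ _ (lebesgue_rV n \x lebesgue_rV n) (lebesgue_rV n)
  (lebesgue_rV n) k qd (fun d t => qx d t.1 * gaussian s2 t.2)%R
  (fun d t => abs_jacobian g d t.1) qx (fun d => noisy s2 (qz d)) p fst
  (fun d t => g d t.1 + t.2)%R).
- exact: mQ.
- by move=> d; exact: mfst.
- exact: hqx.
- by move=> d; exact: measurable_noisy.
- exact: hp.
- exact: measurable_fst.
- by move=> d; exact: measurable_noisy_sum.
- exact: hqd.
- by move=> d t; rewrite mulr_ge0// gaussian_ge0.
- by move=> d t; exact: J0.
- by move=> d z; exact: noisy_ge0.
(* A zero of [qx d] would make the joint density vanish. *)
- move=> d [x e] /= h; rewrite lt_neqAle qx0 andbT; apply: contraTneq h => <-.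
  by rewrite mul0r ltxx.
- by move=> d F mF F0; exact: expect_noise_fst.
(* Integrate out the noise on both sides; what is left is the image law of [g d] applied to the
   Gaussian average of [F]. *)
- move=> d F mF F0; rewrite [LHS](expect_noise (lebesgue_rV n) s2 (mqx d) (qx0 d) (mg d) mF F0).
  rewrite -[RHS](integral_noisy s0 (mqz d) (qz0 d) (qz1 d) mF F0).
  have mid : measurable_fun [set: 'rV[R]_n] (@id 'rV[R]_n) by exact: measurable_id.
  have Phi0 z : 0 <= \int[lebesgue_rV n]_e ((gaussian s2 e)%:E * F (z + e)%R).
    by apply: integral_ge0 => e _; rewrite mule_ge0// lee_fin gaussian_ge0.
  exact: (expect_density_of_image (mqx d) (qx0 d) (mg d) (hqz d)
    (measurable_integral_noise s2 mid mF F0) Phi0).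
- move=> d F mF F0.
  have mFw : measurable_fun [set: ('rV[R]_n * 'rV[R]_n)%type]
      (fun t => F (g d t.1 + t.2)%R).
    exact: (measurableT_comp mF (measurable_noisy_sum (mg d))).
  apply: (@le_trans _ _ (expect (lebesgue_rV n \x lebesgue_rV n)
     (fun t => abs_jacobian g d t.1 * gaussian s2 t.2)%R
     (fun t => F (g d t.1 + t.2)%R))).
    apply: ge0_le_integral.
    + exact: measurableT.
    + move=> [x e] _ /=; rewrite mule_ge0// lee_fin mulr_ge0 ?invr_ge0//.
      by rewrite mulr_ge0// mulr_ge0// gaussian_ge0.
    + apply: emeasurable_funM; last exact: mFw.
      apply/measurable_EFinP; apply: measurable_funM.
        by apply: measurable_funM; [exact: mQ|exact: mfst].
      by apply: measurable_fun_inv_ge0; [move=> t; exact: qx0|exact: mfst].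
    + apply: emeasurable_funM; last exact: mFw.
      apply/measurable_EFinP; apply: measurable_funM; first exact: mfst.
      exact: measurable_gaussian_comp.
    + move=> [x e] _ /=; rewrite lee_wpmul2r// lee_fin.
      (* Where [qx d x] is nonzero it cancels exactly; where it is zero, division by zero yields 0,
         which explains the inequality. *)
      have [->|qx_neq0] := eqVneq (qx d x) 0%R.
        by rewrite !mul0r mulr_ge0// gaussian_ge0.
      by rewrite [leLHS](_ : _ = abs_jacobian g d x * gaussian s2 e)%R//; field.
  apply: (expect_noise_le (mJ d) (J0 d) (mg d) mF F0) => w.
  have [h [gh hg' _ dh]] := hg d.
  rewrite -(integral_gaussian_subr w s0).
  (* The area inequality is applied to the Gaussian centred at [w], which has mass 1. *)
  apply: (area_inequality gh hg' (dg d) dh).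
    exact: continuous_gaussian_subr.
  by move=> z; exact: gaussian_ge0.
- exact: fin_loss.
- exact: fin_qx.
- exact: fin_r.
- exact: fin_m.
Qed.

End flow_bound.

(** * The latent marginal of a probabilistic encoder *)

Section latent_marginal.
Context {R : realType} d1 d2 (X : measurableType d1) (Z : measurableType d2)
  (nu : {sigma_finite_measure set X -> \bar R})
  (lam : {sigma_finite_measure set Z -> \bar R}) (q : X -> R) (e : X -> Z -> R).
Hypotheses (hq : is_density nu q) (he : is_cond_density lam e).

Let mq : measurable_fun [set: X] q. Proof. by case: hq. Qed.
Let q0 x : (0 <= q x)%R. Proof. by case: hq. Qed.
Let e0 x z : (0 <= e x z)%R. Proof. by have [] := he.2 x. Qed.

(** The extended-real marginal, kept apart from its real-valued version because it may be infinite
    at some points. *)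
Let marginal z := \int[nu]_x (q x * e x z)%:E.

Lemma measurable_joint :
  measurable_fun [set: (X * Z)%type] (fun s => q s.1 * e s.1 s.2)%R.
Proof.
apply: measurable_funM; first exact: (measurableT_comp mq measurable_fst).
exact: he.1.
Qed.

Let measurable_ejoint :
  measurable_fun [set: (X * Z)%type] (fun s => (q s.1 * e s.1 s.2)%R%:E).
Proof. by apply/measurable_EFinP; exact: measurable_joint. Qed.

Let joint0 (s : X * Z) : 0 <= (q s.1 * e s.1 s.2)%R%:E.
Proof. by rewrite lee_fin mulr_ge0. Qed.

Let measurable_marginal : measurable_fun [set: Z] marginal.
Proof.
exact: (measurable_fun_fubini_tonelli_G (m1 := nu) _ measurable_ejoint joint0).
Qed.

Let marginal0 z : 0 <= marginal z.
Proof. by apply: integral_ge0 => x _; exact: (joint0 (x, z)). Qed.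

Lemma expect_joint_fst (F : X -> \bar R) :
  measurable_fun [set: X] F -> (forall x, 0 <= F x) ->
  expect (nu \x lam) (fun s => q s.1 * e s.1 s.2)%R (fun s => F s.1) =
  expect nu q F.
Proof.
move=> mF F0.
have mH : measurable_fun [set: (X * Z)%type]
    (fun s => (q s.1 * e s.1 s.2)%R%:E * F s.1).
  by apply: emeasurable_funM => //; exact: (measurableT_comp mF measurable_fst).
have H0 (s : X * Z) : 0 <= (q s.1 * e s.1 s.2)%R%:E * F s.1 by rewrite mule_ge0.
rewrite /expect (fubini_tonelli1 _ mH H0); apply: eq_integral => x _.
have [mex _ ex1] := he.2 x.
rewrite /fubini_F /=; under eq_integral do rewrite (mulrC (q x)) EFinM -muleA.
rewrite ge0_integralZr.
- by rewrite ex1 mul1e.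
- exact: measurableT.
- exact/measurable_EFinP.
- by move=> z _; rewrite lee_fin.
- by rewrite mule_ge0// lee_fin.
Qed.

Let expect_joint_marginal (F : Z -> \bar R) :
  measurable_fun [set: Z] F -> (forall z, 0 <= F z) ->
  expect (nu \x lam) (fun s => q s.1 * e s.1 s.2)%R (fun s => F s.2) =
  \int[lam]_z (marginal z * F z).
Proof.
move=> mF F0.
have mH : measurable_fun [set: (X * Z)%type]
    (fun s => (q s.1 * e s.1 s.2)%R%:E * F s.2).
  by apply: emeasurable_funM => //; exact: (measurableT_comp mF measurable_snd).
have H0 (s : X * Z) : 0 <= (q s.1 * e s.1 s.2)%R%:E * F s.2 by rewrite mule_ge0.
rewrite /expect (fubini_tonelli2 _ mH H0); apply: eq_integral => z _.
rewrite /fubini_G /= ge0_integralZr//.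
- exact: (measurable_fun_pair1 z measurable_ejoint).
- by move=> x _; exact: (joint0 (x, z)).
Qed.

Let integral_marginal : \int[lam]_z marginal z = 1.
Proof.
transitivity (\int[lam]_z (marginal z * cst 1 z)).
  by apply: eq_integral => z _; rewrite mule1.
rewrite -expect_joint_marginal//.
have -> := @expect_joint_fst (cst 1) (measurable_cst _) (fun=> lee01).
by rewrite /expect; under eq_integral do rewrite mule1; case: hq.
Qed.

(** The marginal has total mass 1, so it is finite almost everywhere. *)
Let marginal_fine : {ae lam, forall z, [set: Z] z -> (fine (marginal z))%:E = marginal z}.
Proof.
have im : lam.-integrable [set: Z] marginal.
  by apply: fin_num_integrable => //; rewrite integral_marginal.
by apply: filterS (integrable_ae measurableT im) => z + _ => /(_ I) /fineK.
Qed.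

Let measurable_fine_marginal : measurable_fun [set: Z] (fun z => fine (marginal z)).
Proof. exact: (measurableT_comp (fine_measurable measurableT) measurable_marginal). Qed.

(** Tonelli gives the identity for the extended-real marginal; replacing infinite values by 0
    changes it only on a null set. *)
Lemma expect_joint_snd (F : Z -> \bar R) :
  measurable_fun [set: Z] F -> (forall z, 0 <= F z) ->
  expect (nu \x lam) (fun s => q s.1 * e s.1 s.2)%R (fun s => F s.2) =
  expect lam (fun z => \int[nu]_x (q x * e x z))%R F.
Proof.
move=> mF F0; rewrite expect_joint_marginal//.
apply: ge0_ae_eq_integral => //.
- exact: emeasurable_funM.
- by apply: emeasurable_funM => //; exact/measurable_EFinP.
- by move=> z _; rewrite mule_ge0.
- by move=> z _; rewrite mule_ge0// lee_fin; exact: fine_ge0 (marginal0 z).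
apply: filterS marginal_fine => z + _ => /(_ I) E.
by rewrite -[in LHS]E.
Qed.

Lemma is_density_marginal : is_density lam (fun z => \int[nu]_x (q x * e x z))%R.
Proof.
split; first exact: measurable_fine_marginal.
  by move=> z; apply: Rintegral_ge0 => x _; rewrite mulr_ge0.
have law1 := expect_joint_snd (F := cst 1) (measurable_cst _) (fun=> lee01).
transitivity (expect lam (fun z => \int[nu]_x (q x * e x z))%R (cst 1)).
  by apply: eq_integral => z _; rewrite mule1.
rewrite -law1 expect_joint_marginal// -[RHS]integral_marginal.
by apply: eq_integral => z _; rewrite mule1.
Qed.

End latent_marginal.

Section sigma_finite_product.
Context {R : realType} d1 d2 (T1 : measurableType d1) (T2 : measurableType d2)
  (m1 : {sigma_finite_measure set T1 -> \bar R})
  (m2 : {sigma_finite_measure set T2 -> \bar R}).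

Let product_measure : {measure set (T1 * T2)%type -> \bar R} := m1 \x m2.

(** Both exhaustions are nondecreasing, so the products of sets of equal index already cover the
    space. *)
Lemma sigma_finite_product : sigma_finite [set: T1 * T2] product_measure.
Proof.
have /sigma_finiteP[F [FT Fnd Ffin]] := sigma_finiteT m1.
have /sigma_finiteP[G [GT Gnd Gfin]] := sigma_finiteT m2.
exists (fun i => F i `*` G i); last first.
  move=> i; have [[mF Fi] [mG Gi]] := (Ffin i, Gfin i).
  split; first exact: measurableX.
  by rewrite [X in X < _](product_measure1E m1 m2 mF mG) lte_mul_pinfty// ge0_fin_numE.
apply/seteqP; split=> // -[x y] _.
have [i _ Fx] : (\bigcup_i F i) x by rewrite -FT.
have [j _ Gy] : (\bigcup_i G i) y by rewrite -GT.
exists (maxn i j) => //; split => /=.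
  have /subsetPset FF := Fnd _ _ (leq_maxl i j); exact: FF.
have /subsetPset GG := Gnd _ _ (leq_maxr i j); exact: GG.
Qed.

(* Inference on [m1 \x m2] only finds the instance for subprobability measures. *)
Definition product_sigma_finite : {sigma_finite_measure set (T1 * T2)%type -> \bar R} :=
  HB.pack_for {sigma_finite_measure set (T1 * T2)%type -> \bar R}
    (Measure.sort product_measure)
    (@Measure_isSigmaFinite.Build _ _ _ product_measure sigma_finite_product).

End sigma_finite_product.

(** * The bound for decoders *)

Section vae_bound.
Context {R : realType} (k m n : nat) (qd : 'I_k -> R) (qx : 'I_k -> 'rV[R]_m -> R)
  (s2 : R) (enc : 'I_k -> 'rV[R]_m -> 'rV[R]_n -> R)
  (p : 'rV[R]_n -> R) (dec : 'I_k -> 'rV[R]_n -> 'rV[R]_m -> R).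
Hypotheses (hqd : is_pmf qd) (hqx : forall d, is_density (lebesgue_rV m) (qx d))
  (s0 : (0 < s2)%R)
  (henc : forall d, is_cond_density (lebesgue_rV n) (enc d))
  (hp : is_density (lebesgue_rV n) p)
  (hdec : forall d, is_cond_density (lebesgue_rV m) (dec d))
  (fin_qx : cond_entropy (lebesgue_rV m) qd qx \is a fin_num)
  (fin_m : entropy (lebesgue_rV n)
        (mixture qd (fun d => noisy s2 (latent qx enc d))) \is a fin_num)
  (fin_r : cond_entropy (lebesgue_rV n) qd (fun d => noisy s2 (latent qx enc d))
        \is a fin_num)
  (fin_loss : nvaub_loss qd qx enc s2 (p, dec) \is a fin_num).

Let S := ('rV[R]_m * 'rV[R]_n)%type.
Let sigma := product_sigma_finite (@lebesgue_rV R m) (@lebesgue_rV R n).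

Let measurable_swapped_dec d : measurable_fun [set: S] (fun s => dec d s.2 s.1).
Proof.
have msw : measurable_fun [set: S] (fun s : S => (s.2, s.1)).
  by apply: measurable_fun_pair; [exact: measurable_snd|exact: measurable_fst].
exact: (measurableT_comp (hdec d).1 msw).
Qed.

Let dec0 d z x : (0 <= dec d z x)%R. Proof. by have [] := (hdec d).2 z. Qed.

Let enc0 d x z : (0 <= enc d x z)%R. Proof. by have [] := (henc d).2 x. Qed.

(** Integrating over [x] first removes the decoder, which is a density in [x] for each [z], and
    leaves a Gaussian in [z]. *)
Let dec_mass d w :
  \int[lebesgue_rV m \x lebesgue_rV n]_s (dec d s.2 s.1 * gaussian s2 (w - s.2))%:E <= 1.
Proof.
have mH : measurable_fun [set: S]
    (fun s => (dec d s.2 s.1 * gaussian s2 (w - s.2))%R%:E).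
  apply/measurable_EFinP; apply: measurable_funM; first exact: measurable_swapped_dec.
  apply: measurable_gaussian_comp; apply: measurable_fun_rV => i.
  under eq_fun do rewrite !mxE; apply: measurable_funB => //.
  exact: (measurableT_comp (measurable_coord_rV i) measurable_snd).
have H0 (s : S) : 0 <= (dec d s.2 s.1 * gaussian s2 (w - s.2))%R%:E.
  by rewrite lee_fin mulr_ge0// gaussian_ge0.
rewrite (fubini_tonelli2 _ mH H0) -(integral_gaussian_subr w s0).
rewrite le_eqVlt; apply/orP; left; apply/eqP; apply: eq_integral => z _.
have [mdz _ dz1] := (hdec d).2 z.
rewrite /fubini_G /=; under eq_integral do rewrite EFinM.
rewrite ge0_integralZr.
- by rewrite dz1 mul1e.
- exact: measurableT.
- exact/measurable_EFinP.
- by move=> x _; rewrite lee_fin.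
- by rewrite lee_fin gaussian_ge0.
Qed.

Lemma njsd_le_nvaub_loss :
  njsd qd (latent qx enc) s2 <=
  nvaub_loss qd qx enc s2 (p, dec) - cond_entropy (lebesgue_rV m) qd qx.
Proof.
have mqx d : measurable_fun [set: 'rV[R]_m] (qx d) by have [] := hqx d.
have qx0 d x : (0 <= qx d x)%R by have [] := hqx d.
have hlat d : is_density (lebesgue_rV n) (latent qx enc d).
  exact: is_density_marginal (hqx d) (henc d).
have mjoint d : measurable_fun [set: S] (fun s => qx d s.1 * enc d s.1 s.2)%R.
  exact: measurable_joint (hqx d) (henc d).
have joint0 d (s : S) : (0 <= qx d s.1 * enc d s.1 s.2)%R by rewrite mulr_ge0.
have mS (f : S -> R) : measurable_fun [set: S] f ->
    measurable_fun [set: (S * 'rV[R]_n)%type] (fun t => f t.1).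
  by move=> mf; exact: (measurableT_comp mf measurable_fst).
have msnd : measurable_fun [set: S] (snd : S -> 'rV[R]_n) by exact: measurable_snd.
have mQ d : measurable_fun [set: (S * 'rV[R]_n)%type]
    (fun t => qx d t.1.1 * enc d t.1.1 t.1.2 * gaussian s2 t.2)%R.
  by apply: measurable_funM; [exact: (mS _ (mjoint d))|exact: measurable_gaussian_comp].
(* The pattern-matching integrands of the loss are rewritten with projections, to fit the general
   bound. *)
have lossE : nvaub_loss qd qx enc s2 (p, dec) = domain_mean qd (fun d =>
    expect ((lebesgue_rV m \x lebesgue_rV n) \x lebesgue_rV n)
      (fun t => qx d t.1.1 * enc d t.1.1 t.1.2 * gaussian s2 t.2)%R
      (fun t => nlog (dec d t.1.2 t.1.1 / enc d t.1.1 t.1.2 * p (t.1.2 + t.2))%R)).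
  apply: eq_bigr => d _; congr (_ * _).
  by apply: eq_integral => -[[x z] e] _.
rewrite lossE; have fin_loss' := fin_loss; rewrite lossE in fin_loss'.
apply: (@gjsd_le_loss _ _ _ _ _ _ _ ((lebesgue_rV m \x lebesgue_rV n) \x lebesgue_rV n)
  (lebesgue_rV m) (lebesgue_rV n) k qd
  (fun d t => qx d t.1.1 * enc d t.1.1 t.1.2 * gaussian s2 t.2)%R
  (fun d t => dec d t.1.2 t.1.1 / enc d t.1.1 t.1.2)%R qx
  (fun d => noisy s2 (latent qx enc d)) p (fun t => t.1.1)
  (fun d t => t.1.2 + t.2)%R).
- exact: mQ.
- move=> d; apply: measurable_funM; first exact: (mS _ (measurable_swapped_dec d)).
  apply: measurable_fun_inv_ge0 => //; exact: (mS _ (henc d).1).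
- exact: hqx.
- by move=> d; have [? ? ?] := hlat d; exact: measurable_noisy.
- exact: hp.
- exact: (measurableT_comp measurable_fst measurable_fst).
- by move=> d; exact: (measurable_noisy_sum msnd).
- exact: hqd.
- by move=> d t; rewrite mulr_ge0 ?joint0// gaussian_ge0.
- by move=> d t; rewrite mulr_ge0 ?invr_ge0.
- by move=> d z; have [? ? ?] := hlat d; exact: noisy_ge0.
- move=> d [[x z] e] /= h; rewrite lt_neqAle qx0 andbT; apply: contraTneq h => <-.
  by rewrite !mul0r ltxx.
- move=> d F mF F0.
  rewrite -[RHS](expect_joint_fst (hqx d) (henc d) mF F0).
  have mF1 : measurable_fun [set: S] (fun s : S => F s.1).
    exact: (measurableT_comp mF measurable_fst).
  exact: (expect_noise_fst sigma n s2 (mjoint d) (joint0 d)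
    mF1 (fun s => F0 s.1)).
- move=> d F mF F0; have [mlat lat0 lat1] := hlat d.
  rewrite [LHS](expect_noise sigma s2 (mjoint d) (joint0 d)
    msnd mF F0).
  rewrite -[RHS](integral_noisy s0 mlat lat0 lat1 mF F0).
  have mid : measurable_fun [set: 'rV[R]_n] (@id 'rV[R]_n) by exact: measurable_id.
  have Phi0 z : 0 <= \int[lebesgue_rV n]_e ((gaussian s2 e)%:E * F (z + e)%R).
    by apply: integral_ge0 => e _; rewrite mule_ge0// lee_fin gaussian_ge0.
  exact: (expect_joint_snd (hqx d) (henc d) (measurable_integral_noise s2 mid mF F0) Phi0).
- move=> d F mF F0.
  have mFw : measurable_fun [set: (S * 'rV[R]_n)%type] (fun t => F (t.1.2 + t.2)%R).
    exact: (measurableT_comp mF (measurable_noisy_sum msnd)).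
  apply: (@le_trans _ _ (expect ((lebesgue_rV m \x lebesgue_rV n) \x lebesgue_rV n)
     (fun t => dec d t.1.2 t.1.1 * gaussian s2 t.2)%R
     (fun t => F (t.1.2 + t.2)%R))).
    apply: ge0_le_integral.
    + exact: measurableT.
    + move=> [[x z] e] _ /=; rewrite mule_ge0// lee_fin !mulr_ge0 ?invr_ge0//.
      exact: gaussian_ge0.
    + apply: emeasurable_funM; last exact: mFw.
      apply/measurable_EFinP; apply: measurable_funM.
        apply: measurable_funM; first exact: mQ.
        apply: measurable_funM; first exact: (mS _ (measurable_swapped_dec d)).
        apply: measurable_fun_inv_ge0 => //; exact: (mS _ (henc d).1).
      apply: measurable_fun_inv_ge0; first by move=> t; exact: qx0.
      exact: (measurableT_comp (mqx d) (measurableT_comp measurable_fst measurable_fst)).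
    + apply: emeasurable_funM; last exact: mFw.
      apply/measurable_EFinP; apply: measurable_funM.
        exact: (mS _ (measurable_swapped_dec d)).
      exact: measurable_gaussian_comp.
    + move=> [[x z] e] _ /=; rewrite lee_wpmul2r// lee_fin.
      (* Both [qx] and the encoder cancel where they are nonzero, leaving decoder times Gaussian;
         elsewhere the left-hand side is 0. *)
      have [->|qx_neq0] := eqVneq (qx d x) 0%R.
        by rewrite !mul0r mulr_ge0// gaussian_ge0.
      have [->|enc_neq0] := eqVneq (enc d x z) 0%R.
        by rewrite mulr0 !mul0r mulr_ge0// gaussian_ge0.
      rewrite [leLHS](_ : _ = dec d z x * gaussian s2 e)%R//.
      by field; apply/andP.
  apply: (expect_noise_le (sigma := sigma)
    (measurable_swapped_dec d) (fun s => dec0 d s.2 s.1) msnd mF F0) => w.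
  exact: dec_mass.
- exact: fin_loss'.
- exact: fin_qx.
- exact: fin_r.
- exact: fin_m.
Qed.

End vae_bound.

(** * Both bounds at an attained minimum *)

Unset Implicit Arguments.

Theorem theorem4 (R : realType) (k m : nat) (hk : (1 < k)%N)
    (qd : 'I_k -> R) (hqd : is_pmf qd)
    (qx : 'I_k -> 'rV[R]_m -> R)
    (hqx : forall d, is_density (lebesgue_rV m) (qx d))
    (hC : cond_entropy (lebesgue_rV m) qd qx \is a fin_num)
    (s2 : R) (hs2 : (0 < s2)%R) :
  (forall (g : 'I_k -> 'rV[R]_m -> 'rV[R]_m)
          (qz : 'I_k -> 'rV[R]_m -> R)
          (P : set ('rV[R]_m -> R)),
      is_flow g ->
      (forall d, is_density_of_image (lebesgue_rV m) (lebesgue_rV m)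
                   (qx d) (g d) (qz d)) ->
      P `<=` is_density (lebesgue_rV m) ->
      entropy (lebesgue_rV m) (mixture qd (fun d => noisy s2 (qz d)))
        \is a fin_num ->
      cond_entropy (lebesgue_rV m) qd (fun d => noisy s2 (qz d))
        \is a fin_num ->
      min_attained P (naub_loss qd qx g s2) ->
      njsd qd qz s2 <= naub qd qx g s2 P)
  /\
  (forall (n : nat)
          (enc : 'I_k -> 'rV[R]_m -> 'rV[R]_n -> R)
          (P : set ('rV[R]_n -> R))
          (D : set ('I_k -> 'rV[R]_n -> 'rV[R]_m -> R)),
      (forall d, is_cond_density (lebesgue_rV n) (enc d)) ->
      P `<=` is_density (lebesgue_rV n) ->
      (forall dec, D dec -> forall d,
          is_cond_density (lebesgue_rV m) (dec d)) ->
      entropy (lebesgue_rV n)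
        (mixture qd (fun d => noisy s2 (latent qx enc d))) \is a fin_num ->
      cond_entropy (lebesgue_rV n) qd (fun d => noisy s2 (latent qx enc d))
        \is a fin_num ->
      min_attained (P `*` D) (nvaub_loss qd qx enc s2) ->
      njsd qd (latent qx enc) s2 <= nvaub qd qx enc s2 P D).
Proof.
split.
(* The minimum is the finite loss of some minimizer, so the bound for that single choice suffices,
   here and in the second part. *)
- move=> g qz P hg hqz hP fin_m fin_r /minimum_attained[p Pp [minE fin_loss]].
  by rewrite /naub minE; apply: njsd_le_naub_loss => //; exact: hP.
- move=> n enc P D henc hP hD fin_m fin_r.
  move=> /minimum_attained[[p dec] [/= Pp Ddec] [minE fin_loss]].
  rewrite /nvaub minE; apply: njsd_le_nvaub_loss => //; first exact: hP.
  exact: hD.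
Qed.
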